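(* Let $d\ge 1$ and $n\ge 1$ be integers such that $2d$ divides $n$. For every simple $d$-regular graph $G$ on $n$ vertices and every integer $k\ge 0$, \[ i_k(G)\le 2\sqrt n\cdot i_k(H_{d,n}) \] and \[ m_k(G)\le 2\sqrt n\cdot m_k(H_{d,n}). \]
   Context: For a finite graph $G$, $i_k(G)$ denotes the number of independent sets of size $k$ in $G$, and $m_k(G)$ denotes the number of matchings of $G$ with exactly $k$ edges. When $2d$ divides $n$, $H_{d,n}$ denotes the $d$-regular $n$-vertex graph that is the disjoint union of $n/(2d)$ copies of the complete bipartite graph $K_{d,d}$. *)

(* Defs.v *)
From mathcomp Require Import all_boot all_order all_algebra.

Set Implicit Arguments.
Unset Strict Implicit.
Unset Printing Implicit Defensive.

Record sgraph := SGraph {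
  vertex :> finType;
  adj : rel vertex;
  adj_sym : symmetric adj;
  adj_irrefl : irreflexive adj }.

Definition regular (G : sgraph) (d : nat) : Prop :=
  forall x : G, #|[set y : G | adj x y]| = d.

Definition independent (G : sgraph) (S : {set G}) : bool :=
  [forall x in S, forall y in S, ~~ adj x y].

Definition edges (G : sgraph) : {set {set G}} :=
  [set [set p.1; p.2] | p : G * G & adj p.1 p.2].

Definition matching (G : sgraph) (M : {set {set G}}) : bool :=
  (M \subset edges G) && trivIset M.

Definition num_indep (G : sgraph) (k : nat) : nat :=
  #|[set S : {set G} | independent S & #|S| == k]|.

Definition num_matching (G : sgraph) (k : nat) : nat :=
  #|[set M : {set {set G}} | matching M & #|M| == k]|.

Section CompleteBipartite.
Variables a b : nat.

Definition bip_adj : rel ('I_a + 'I_b)%type := fun u v =>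
  match u, v with
  | inl _, inr _ | inr _, inl _ => true
  | _, _ => false
  end.

Lemma bip_adj_sym : symmetric bip_adj. Proof. by case=> ? []. Qed.
Lemma bip_adj_irrefl : irreflexive bip_adj. Proof. by case. Qed.

Definition complete_bipartite : sgraph := SGraph bip_adj_sym bip_adj_irrefl.
End CompleteBipartite.

Section Copies.
Variables (m : nat) (G : sgraph).

Definition copies_adj : rel ('I_m * G)%type := fun u v =>
  (u.1 == v.1) && adj u.2 v.2.

Lemma copies_adj_sym : symmetric copies_adj.
Proof. by move=> u v; rewrite /copies_adj eq_sym adj_sym. Qed.

Lemma copies_adj_irrefl : irreflexive copies_adj.
Proof. by move=> u; rewrite /copies_adj adj_irrefl andbF. Qed.

Definition copies : sgraph := SGraph copies_adj_sym copies_adj_irrefl.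
End Copies.

(* Meaningful when [2 * d %| n]: see [card_H] and [H_regular]. *)
Definition H (d n : nat) : sgraph :=
  copies (n %/ (2 * d)) (complete_bipartite d d).

Lemma card_H (d n : nat) : 2 * d %| n -> #|H d n| = n.
Proof.
by move=> dvd; rewrite card_prod card_sum !card_ord addnn -mul2n divnK.
Qed.

Lemma H_regular (d n : nat) : regular (H d n) d.
Proof.
case=> i u; rewrite -[RHS]card_ord.
pose f (j : 'I_d) : H d n := (i, if u is inl _ then inr j else inl j).
have f_inj : injective f by rewrite /f; case: u {f} => ? x y [].
rewrite -(card_imset predT f_inj); apply: eq_card => -[i' v].
rewrite inE; apply/andP/imsetP => /= [[/eqP<-] | [j _ [-> ->]]].
  rewrite /f; case: u v {f f_inj} => x [] y //= _; by exists y.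
by rewrite eqxx; case: u {f f_inj}.
Qed.

(* Main.v *)
Require Import Defs.
From mathcomp Require Import all_boot all_order all_algebra.
From mathcomp Require Import polyrcf zify ring lra.
Set Implicit Arguments.
Unset Strict Implicit.
Unset Printing Implicit Defensive.
Import Order.TTheory GRing.Theory Num.Theory.
Local Open Scope ring_scope.

(** Let [P] be the independence or the matching polynomial.  The occupancy method
    of Davies, Jenssen, Perkins and Roberts bounds [P_G' / P_G] by [P_H' / P_H] at
    every [x > 0]: reveal a random configuration away from a vertex (an edge),
    write the occupancy as an average over the resulting local configurations,
    and exhibit a dual certificate for the linear program formed by the local
    consistency constraints.  Hence [P_G x <= P_H x = Q x ^+ m], where [Q] is the
    polynomial of [K_{d,d}] and [m = n / (2 d)].

    The coefficients of [Q] are ultra log-concave of order [d], so the size under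
    the [x]-weighted law of [H] has variance at most [n / 8], and the coefficients
    of [Q ^+ m] are log-concave.  Choose [x] for which [k] is a mode of that law.
    A law on the integers with variance [v] and maximal weight [M] satisfies
    [12 v + 1 >= 1 / M ^+ 2]; a weaker version of this gives
    [P_H x <= 2 sqrt n * h_k x ^+ k], and [f_k x ^+ k <= P_G x <= P_H x]. *)

(** * Variance of ultra log-concave sequences *)

(** The bound n / 8 is m times d / 4: ultra log-concavity of order d bounds the variance of one copy
    of K_{d,d} by that of a binomial law with d trials and the same mean, hence by that of d fair
    coins. Variance n / 8 alone would lead to a constant near sqrt (3 / 2) for large n; the margin
    up to 2 pays for a window whose centre and radius are rounded to integers. Each dual certificate
    is forced by being tight on the local configurations that occur in K_{d,d}. For independent sets
    there are two of them, which gives a closed form. For matchings they form a chain, so the dual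
    variables solve a recurrence, and two obstacles arise: the recurrence has one equation more than
    unknowns, and an edge whose ends have common neighbours is controlled only through monotonicity
    of the solution. *)

Lemma chebyshev_sum (R : realFieldType) (I : finType) (w f g : I -> R) :
    (forall i, 0 <= w i) -> (forall i j, (f i - f j) * (g i - g j) <= 0) ->
  (\sum_i w i) * (\sum_i w i * f i * g i) <=
  (\sum_i w i * f i) * (\sum_i w i * g i).
Proof.
move=> w0 fg.
have E : \sum_i \sum_j w i * w j * ((f i - f j) * (g i - g j)) =
  2 * ((\sum_i w i) * (\sum_i w i * f i * g i) -
       (\sum_i w i * f i) * (\sum_i w i * g i)).
  transitivity (\sum_i (\sum_j w i * f i * g i * w j
     + \sum_j w i * (w j * f j * g j) - \sum_j w i * f i * (w j * g j)
     - \sum_j w i * g i * (w j * f j))).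
    apply: eq_bigr => i _; rewrite -big_split -!sumrB /=.
    by apply: eq_bigr => j _; ring.
  under eq_bigr => i _ do rewrite -!mulr_sumr.
  by rewrite !sumrB big_split /= -!mulr_suml; ring.
suff : 2 * ((\sum_i w i) * (\sum_i w i * f i * g i) -
       (\sum_i w i * f i) * (\sum_i w i * g i)) <= 0 by lra.
rewrite -E; apply: sumr_le0 => i _; apply: sumr_le0 => j _.
by rewrite mulr_ge0_le0 // mulr_ge0.
Qed.

Section Theta.
Variable R : realFieldType.
Implicit Types p q : {poly R}.

(** The Euler operator: [(theta p).[x] / p.[x]] is the mean of the law with weights p_k x^k, and a
    second application gives the second moment. *)
Definition theta p := 'X * p^`().

Lemma coef_theta p i : (theta p)`_i = i%:R * p`_i.
Proof. by rewrite coefXM coef_deriv; case: i => [|i] /=; rewrite ?mul0r // mulr_natl. Qed.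

Lemma thetaM p q : theta (p * q) = theta p * q + p * theta q.
Proof. by rewrite /theta derivM; ring. Qed.

Lemma thetaD p q : theta (p + q) = theta p + theta q.
Proof. by rewrite /theta derivD mulrDr. Qed.

Lemma size_theta p : (size (theta p) <= size p)%N.
Proof. by apply/leq_sizeP => j /leq_sizeP pj; rewrite coef_theta pj ?mulr0. Qed.

(* The left-hand side is the variance of the law [k |-> p`_k x ^+ k / p.[x]]
   multiplied by [p.[x] ^+ 2]. *)
Definition var_le p x (c : R) :=
  (theta (theta p)).[x] * p.[x] - (theta p).[x] ^+ 2 <= c * p.[x] ^+ 2.

(** A product of polynomials is the law of a sum of independent variables, so variances add: [theta]
    is a derivation and the cross terms cancel. *)
Lemma var_leM p q x c e :
  var_le p x c -> var_le q x e -> var_le (p * q) x (c + e).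
Proof.
rewrite /var_le !(thetaM, thetaD).
move: (theta (theta p)) (theta p) (theta (theta q)) (theta q) => p2 p1 q2 q1.
rewrite !(hornerM, hornerD) => /(ler_wpM2r (sqr_ge0 q.[x])) vp.
move=> /(ler_wpM2r (sqr_ge0 p.[x])) vq.
lra.
Qed.

Lemma var_leX p x c m : var_le p x c -> var_le (p ^+ m) x (m%:R * c).
Proof.
move=> vp; elim: m => [|m IH].
  have t0 : theta (p ^+ 0) = 0 by rewrite expr0 /theta derivC mulr0.
  by rewrite /var_le t0 /theta deriv0 mulr0 !horner0; lra.
by rewrite exprS -natr1 mulrDl mul1r addrC; apply: var_leM.
Qed.

(** Up to the factor [b k], the coefficient ratio is that of the binomial law, so monotonicity of
    [b] is ultra log-concavity of order [d]. Chebyshev's inequality for the oppositely ordered b_k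
    and k + 1, under the weights (d - k) p_k x^k, gives d (S0 S2 - S1^2) <= S1 (d S0 - S1), and the
    right-hand side is at most d^2 S0^2 / 4. *)
Lemma ultra_log_concave_var (d : nat) p (b : nat -> R) x :
    (0 < d)%N -> 0 <= x -> (size p <= d.+1)%N -> (forall k, 0 <= p`_k) ->
    (forall k, k.+1%:R * p`_k.+1 = b k * ((d%:R - k%:R) * p`_k)) ->
    {homo b : i j / (i <= j)%N >-> j <= i} ->
  var_le p x (d%:R / 4).
Proof.
move=> d0 x0 sp p0 pS bd; rewrite /var_le.
have szT := leq_trans (size_theta p) sp.
have szTT := leq_trans (size_theta _) szT.
rewrite (horner_coef_wide _ sp) (horner_coef_wide _ szT) (horner_coef_wide _ szTT).
set S2 := (X in X * _ - _); set S1 := (X in _ - X ^+ 2); set S0 := (X in _ * X ^+ 2); rewrite -/S0.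
pose w (k : 'I_d.+1) := (d%:R - k%:R) * (p`_k * x ^+ k).
have shift (F : nat -> R) : \sum_(k < d.+1) F k * (k%:R * (p`_k * x ^+ k)) =
    x * \sum_k w k * b k * F k.+1.
  rewrite big_ord_recl mul0r mulr0 add0r [in RHS]big_ord_recr /=.
  rewrite [w ord_max]/w subrr !mul0r addr0 mulr_sumr.
  apply: eq_bigr => k _; rewrite /w /bump /= add1n exprS.
  by transitivity (F k.+1 * x * x ^+ k * (k.+1%:R * p`_k.+1)); [ring | rewrite pS; ring].
have ES1 : S1 = x * \sum_k w k * b k.
  transitivity (\sum_(k < d.+1) 1 * (k%:R * (p`_k * x ^+ k))).
    by apply: eq_bigr => k _; rewrite coef_theta; ring.
  by rewrite (shift (fun=> 1)); congr (_ * _); apply: eq_bigr => k _; rewrite mulr1.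
have ES2 : S2 = x * \sum_k w k * b k * (k%:R + 1).
  transitivity (\sum_(k < d.+1) k%:R * (k%:R * (p`_k * x ^+ k))).
    by apply: eq_bigr => k _; rewrite !coef_theta; ring.
  rewrite (shift (fun k => k%:R)); congr (_ * _).
  by apply: eq_bigr => k _; rewrite natr1.
have Ew : \sum_k w k = d%:R * S0 - S1.
  rewrite /S0 /S1 mulr_sumr -sumrB; apply: eq_bigr => k _.
  by rewrite coef_theta /w; ring.
have Ewk : \sum_k w k * (k%:R + 1) = d%:R * S1 + d%:R * S0 - S2 - S1.
  rewrite /S0 /S1 /S2 !mulr_sumr -big_split -!sumrB; apply: eq_bigr => k _.
  by rewrite !coef_theta /w /=; ring.
have cheb : (\sum_k w k) * (\sum_k w k * b k * (k%:R + 1)) <=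
    (\sum_k w k * b k) * (\sum_k w k * (k%:R + 1)).
  apply: chebyshev_sum => [k | i j].
    by rewrite !mulr_ge0 ?exprn_ge0 // subr_ge0 ler_nat -ltnS.
  rewrite opprD addrACA subrr addr0; case: (leqP i j) => [|/ltnW] ij.
    by rewrite mulr_ge0_le0 ?subr_ge0 ?subr_le0 ?bd ?ler_nat.
  by rewrite mulr_le0_ge0 ?subr_ge0 ?subr_le0 ?bd ?ler_nat.
have {cheb} := ler_wpM2l x0 cheb.
rewrite mulrCA -ES2 mulrA -ES1 Ew Ewk => le2.
have d0' : 0 < d%:R :> R by rewrite ltr0n.
rewrite -(ler_pM2l d0'); move: S0 S1 S2 le2 {ES1 ES2 Ew Ewk} => S0 S1 S2 le2.
have := sqr_ge0 (S1 - d%:R / 2 * S0); lra.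
Qed.

End Theta.

(** * Log-concavity and the largest coefficient *)

Section Toeplitz.
Variable R : realFieldType.
Implicit Types p q : {poly R}.

(** Entries of the infinite lower triangular Toeplitz matrix of the coefficients. For nonnegative
    coefficients, nonnegativity of its 2 x 2 minors is log-concavity without internal zeros, in a
    form that passes to products. *)
Definition toep p i a := if (a <= i)%N then p`_(i - a) else 0.

Definition tp2 p := forall i i' a b, (i < i')%N -> (a < b)%N ->
  toep p i b * toep p i' a <= toep p i a * toep p i' b.

Lemma toepM p q i j K : (i < K)%N ->
  toep (p * q) i j = \sum_(a < K) toep p i a * toep q a j.
Proof.
move=> iK; rewrite (bigID (fun a : 'I_K => (j <= a <= i)%N)) /=.
rewrite [X in _ + X]big1 ?addr0 => [|a]; last first.
  by rewrite negb_and /toep => /orP[]/negPf ->; rewrite ?mulr0 ?mul0r.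
rewrite {1}/toep; case: leqP => ij; last first.
  by rewrite big1 // => a /andP[ja ai]; have := leq_trans ja ai; rewrite leqNgt ij.
have lt (l : 'I_(i - j).+1) : (j + l < K)%N by have := ltn_ord l; lia.
rewrite coefMr (reindex (fun l : 'I_(i - j).+1 => Ordinal (lt l))) /=.
  apply: eq_big => l; first by have := ltn_ord l; lia.
  have := ltn_ord l => li _; rewrite /toep.
  by rewrite ifT 1?ifT; [congr (p`__ * q`__); lia | lia | lia].
exists (fun a : 'I_K => inord (a - j)) => [l _ | a /andP[ja ai]].
  by apply: val_inj; rewrite /= addKn inord_val.
by apply: val_inj; rewrite /= inordK; lia.
Qed.

(* Cauchy-Binet for the 2 x 2 minors of a product of Toeplitz matrices. *)
Lemma tp2M p q : tp2 p -> tp2 q -> tp2 (p * q).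
Proof.
move=> tp tq i i' j j' ii' jj'.
have iK : (i < i'.+1)%N by rewrite ltnS ltnW.
rewrite -subr_ge0 !(toepM _ _ _ iK) !(toepM p q _ (ltnSn i')).
set F := fun (a : 'I_i'.+1) => toep p i a; set F' := fun (a : 'I_i'.+1) => toep p i' a.
set G := fun (a : 'I_i'.+1) => toep q a j; set G' := fun (a : 'I_i'.+1) => toep q a j'.
have E : \sum_a \sum_b (F a * F' b - F b * F' a) * (G a * G' b - G b * G' a) =
  2 * ((\sum_a F a * G a) * (\sum_a F' a * G' a) -
       (\sum_a F a * G' a) * (\sum_a F' a * G a)).
  transitivity (\sum_a (\sum_b F a * G a * (F' b * G' b)
     + \sum_b F' a * G' a * (F b * G b) - \sum_b F a * G' a * (F' b * G b)
     - \sum_b F' a * G a * (F b * G' b))).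
    apply: eq_bigr => a _; rewrite -big_split -!sumrB /=.
    by apply: eq_bigr => b _; ring.
  under eq_bigr => a _ do rewrite -!mulr_sumr.
  by rewrite !sumrB big_split /= -!mulr_suml; ring.
rewrite -(@pmulr_rge0 _ 2) // -E; apply: sumr_ge0 => a _; apply: sumr_ge0 => b _.
case: (ssrnat.ltngtP a b) => [ab | ba | /val_inj ->]; last by rewrite !subrr mul0r.
  apply: mulr_ge0; rewrite subr_ge0; first exact: (tp _ _ _ _ ii' ab).
  by rewrite [X in X <= _]mulrC; exact: (tq _ _ _ _ ab jj').
apply: mulr_le0; rewrite subr_le0; first exact: (tp _ _ _ _ ii' ba).
by rewrite [X in X <= _]mulrC; exact: (tq _ _ _ _ ba jj').
Qed.

Lemma tp2_1 : tp2 1.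
Proof.
move=> i i' a b ii' ab; rewrite /toep !coef1.
case: (leqP b i) => bi; last by rewrite mul0r mulr_ge0 //; case: ifP.
have -> : (i' - a == 0)%N = false by lia.
by rewrite [X in _ * X](_ : _ = 0) ?mulr0 ?mulr_ge0 //; case: ifP.
Qed.

Lemma tp2X p m : tp2 p -> tp2 (p ^+ m).
Proof.
move=> tp; elim: m => [|m IH]; first exact: tp2_1.
by rewrite exprS; apply: tp2M.
Qed.

Lemma tp2_ratio p (r : nat -> R) : (forall k, 0 <= p`_k) ->
    (forall k, p`_k.+1 = r k * p`_k) -> (forall k, 0 <= r k) ->
    {homo r : i j / (i <= j)%N >-> j <= i} -> tp2 p.
Proof.
move=> p0 pS r0 rd i i' a b ii' ab; rewrite /toep.
case: (leqP b i) => bi; last first.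
  by rewrite mul0r mulr_ge0 //; case: ifP.
rewrite !ifT; try lia.
(* The minor becomes p_x p_(y+l) <= p_(x+l) p_y with x <= y; raising l by one multiplies the two
   sides by r (y + l) <= r (x + l). *)
have [x [y [l [-> [-> [-> [-> xy]]]]]]] : exists x y l,
   (i - b = x /\ i' - a = y + l /\ i - a = x + l /\ i' - b = y /\ x <= y)%N.
  by exists (i - b)%N, (i' - b)%N, (b - a)%N; lia.
elim: l => [|l IH]; first by rewrite !addn0.
rewrite !addnS !pS mulrCA -mulrA; apply: ler_pM => //.
- by rewrite mulr_ge0.
- by apply: rd; rewrite leq_add2r.
Qed.

(** At this [x] the terms of index k and k + 1 are equal, and log-concavity makes the terms decrease
    away from the pair on both sides. *)
Lemma tp2_mode p k : tp2 p -> 0 < p`_k -> 0 < p`_k.+1 ->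
  let x := p`_k / p`_k.+1 in forall j, p`_j * x ^+ j <= p`_k.+1 * x ^+ k.+1.
Proof.
move=> tp pk pk1 x j.
have x0 : 0 < x by rewrite divr_gt0.
have up l : p`_(k.+1 + l) * x ^+ (k.+1 + l) <= p`_k.+1 * x ^+ k.+1.
  elim: l => [|l IH]; first by rewrite addn0.
  apply: le_trans IH; rewrite addnS exprS mulrA ler_pM2r ?exprn_gt0 //.
  rewrite /x mulrA ler_pdivrMr //.
  have := tp k.+1 (k.+1 + l).+1 0%N 1%N; rewrite /toep /= !subn0 !subn1 /= => H.
  by rewrite [X in X <= _]mulrC [X in _ <= X]mulrC; apply: H => //; lia.
case: (leqP k.+1 j) => [kj|]; first by rewrite -(subnKC kj).
rewrite ltnS => jk; rewrite -(subKn jk); elim: (k - j)%N => [|l IH].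
  by rewrite subn0 exprS mulrA /x mulrCA divff ?lt0r_neq0 // mulr1.
apply: le_trans IH; rewrite subnS; case: (k - l)%N (leq_subr l k) => //= i ik.
rewrite exprS mulrA ler_pM2r ?exprn_gt0 // /x mulrA ler_pdivlMr //.
have [-> | ik'] := eqVneq i k; first by lra.
have := tp i.+1 k.+1 0%N 1%N; rewrite /toep /= !subn0 !subn1 /= => H.
by apply: H => //; lia.
Qed.

Lemma coefM_gt0 p q d e : (forall k, 0 <= p`_k) -> (forall k, 0 <= q`_k) ->
    (forall k, (k <= d)%N -> 0 < p`_k) -> (forall k, (k <= e)%N -> 0 < q`_k) ->
  forall k, (k <= d + e)%N -> 0 < (p * q)`_k.
Proof.
move=> p0 q0 pp qp k kde; rewrite coefM.
have lt : (minn k d < k.+1)%N by lia.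
rewrite (bigD1 (Ordinal lt)) //= ltr_pwDl //.
  by rewrite mulr_gt0 ?pp ?qp; lia.
by apply: sumr_ge0 => i _; rewrite mulr_ge0.
Qed.

Lemma coefM_ge0 p q : (forall k, 0 <= p`_k) -> (forall k, 0 <= q`_k) ->
  forall k, 0 <= (p * q)`_k.
Proof. by move=> p0 q0 k; rewrite coefM sumr_ge0 // => i _; rewrite mulr_ge0. Qed.

Lemma coefX_ge0 p m : (forall k, 0 <= p`_k) -> forall k, 0 <= (p ^+ m)`_k.
Proof.
move=> p0; elim: m => [k|m IH]; first by rewrite coef1; case: eqP.
by rewrite exprS; apply: coefM_ge0.
Qed.

Lemma coefX_gt0 p d m : (forall k, 0 <= p`_k) -> (forall k, (k <= d)%N -> 0 < p`_k) ->
  forall k, (k <= m * d)%N -> 0 < (p ^+ m)`_k.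
Proof.
move=> p0 pp; elim: m => [k|m IH].
  by rewrite leqn0 => /eqP ->; rewrite coef1 ltr01.
by rewrite exprS mulSn; apply: coefM_gt0 => //; apply: coefX_ge0.
Qed.

End Toeplitz.

(** * Largest weight of a law on the integers with bounded variance *)

Section Window.
Variable R : rcfType.

(** Subtraction takes place in [nat], so the summand is a positive part and vanishes from i = r on;
    the right-hand side is the sum over i < r. *)
Lemma sum_half_window (r K : nat) :
  \sum_(i < K) (r ^ 2 - i ^ 2)%:R <= (4 * r%:R ^+ 3 + 3 * r%:R ^+ 2 - r%:R) / 6 :> R.
Proof.
have E k : (k <= r)%N -> \sum_(i < k) (r ^ 2 - i ^ 2)%:R =
    k%:R * r%:R ^+ 2 - (2 * k%:R ^+ 3 - 3 * k%:R ^+ 2 + k%:R) / 6 :> R.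
  elim: k => [|k IH] kr; first by rewrite big_ord0; lra.
  rewrite big_ord_recr /= IH ?(ltnW kr) // natrB ?leq_exp2r 1?ltnW // !natrX -natr1.
  by field.
have Z l : \sum_(i < r + l) (r ^ 2 - i ^ 2)%:R = \sum_(i < r) (r ^ 2 - i ^ 2)%:R :> R.
  elim: l => [|l IH]; first by rewrite addn0.
  rewrite addnS big_ord_recr /= IH (_ : r ^ 2 - (r + l) ^ 2 = 0)%N ?addr0 //.
  by apply/eqP; rewrite subn_eq0 leq_exp2r ?leq_addr.
apply: (@le_trans _ _ (\sum_(i < r + K) (r ^ 2 - i ^ 2)%:R)).
  rewrite addnC big_split_ord /= lerDl; exact: sumr_ge0.
rewrite Z E //; lra.
Qed.

(** In [nat], (j - c) + (c - j) is the distance from j to c. Two half windows cover the window and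
    share only the term r^2 at the centre. *)
Lemma sum_window (r c K : nat) :
  \sum_(j < K) (r ^ 2 - ((j - c) + (c - j)) ^ 2)%:R <=
    (4 * r%:R ^+ 3 - r%:R) / 3 :> R.
Proof.
apply: (@le_trans _ _ (\sum_(j < c + K) (r ^ 2 - ((j - c) + (c - j)) ^ 2)%:R)).
  rewrite addnC big_split_ord /= lerDl; exact: sumr_ge0.
rewrite big_split_ord /=.
have -> : \sum_(i < K) (r ^ 2 - (c + i - c + (c - (c + i))) ^ 2)%:R =
    \sum_(i < K) (r ^ 2 - i ^ 2)%:R :> R.
  by apply: eq_bigr => i _; congr (_ - _ ^ 2)%:R; lia.
have -> : \sum_(i < c) (r ^ 2 - (i - c + (c - i)) ^ 2)%:R =
    \sum_(i < c.+1) (r ^ 2 - i ^ 2)%:R - r%:R ^+ 2 :> R.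
  rewrite big_ord_recl /= subn0 natrX addrC addKr.
  rewrite (reindex_inj rev_ord_inj) /=; apply: eq_bigr => i _.
  by congr (_ - _ ^ 2)%:R; have := ltn_ord i; rewrite /bump /=; lia.
have := sum_half_window r K; have := sum_half_window r c.+1; lra.
Qed.

Lemma nearest_nat (N : nat) (u : R) : 0 <= u <= N%:R ->
  exists c : nat, (u - c%:R) ^+ 2 <= 1 / 4.
Proof.
elim: N => [|N IH] /andP[u0 uN]; first by exists 0%N; nra.
case: (lerP u N%:R) => [uN'|Nu]; first by apply: IH; rewrite u0.
move: uN; rewrite -natr1 => uN.
by case: (lerP u (N%:R + 1 / 2)) => h; [exists N | exists N.+1; rewrite -natr1]; nra.
Qed.

Lemma nat_sqrt (n : nat) : (1 <= n)%N -> let s := Num.sqrt (n%:R : R) in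
  exists2 r : nat, (1 <= r)%N & r%:R <= s <= r%:R + 1.
Proof.
move=> n1 s.
have [r /andP[rn nr]] : exists r, (r ^ 2 <= n < r.+1 ^ 2)%N.
  elim: n {n1 s} => [|n [r /andP[rn nr]]]; first by exists 0%N.
  case: (ltnP n.+1 (r.+1 ^ 2)) => h; [exists r | exists r.+1]; first by lia.
  by rewrite h /=; move: nr; rewrite -!mulnn; lia.
exists r; first by case: r nr {rn} => //; lia.
have sq l : l%:R = Num.sqrt ((l ^ 2)%:R : R) by rewrite natrX sqrtr_sqr ger0_norm.
by rewrite natr1 (sq r) (sq r.+1) /s !ler_sqrt ?ler0n // !ler_nat rn ltnW.
Qed.

(** Here y is the integer radius, y + t is sqrt n, and the subtracted terms are the variance bound n
    / 8 and the cost 1 / 4 of rounding the mean. The difference of the two sides is cubic in t: it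
    is interpolated between its values at t = 0 and t = 1, and the remainder is t (1 - t) times a
    nonnegative factor. Equality occurs at y = t = 1. *)
Lemma window_cubic (y t : R) : 1 <= y -> 0 <= t -> t <= 1 ->
  4 * y ^+ 3 - y <= 6 * (y + t) * (y ^+ 2 - (y + t) ^+ 2 / 8 - 1 / 4).
Proof.
move=> y1 t0 t1; have s0 : 0 <= 1 - t by rewrite subr_ge0.
have tt : 0 <= t * (1 - t) by rewrite mulr_ge0.
have ttt : 0 <= t * (t * (1 - t)) by rewrite mulr_ge0.
have ytt : 0 <= y * (t * (1 - t)) by rewrite mulr_ge0 // (le_trans ler01).
have : 0 <= (1 - t) * (5 * y ^+ 3 - 2 * y) by rewrite mulr_ge0 //; nra.
have : 0 <= t * (5 * y ^+ 3 + 15 * y ^+ 2 - 11 * y - 9) by rewrite mulr_ge0 //; nra.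
lra.
Qed.

(* Compare [r ^+ 2 - (j - c) ^+ 2] averaged under the law [h`_j x ^+ j / h.[x]] with
   its sum over a window, for [c] nearest to the mean and [r] the floor of [sqrt n]. *)
Lemma max_coef_lower_bound (n N k : nat) (h : {poly R}) (x : R) :
    (1 <= n)%N -> 0 <= x -> (size h <= N.+1)%N -> (forall j, 0 <= h`_j) ->
    0 < h.[x] -> var_le h x (n%:R / 8) ->
    (forall j, h`_j * x ^+ j <= h`_k * x ^+ k) ->
  h.[x] <= 2 * Num.sqrt n%:R * (h`_k * x ^+ k).
Proof.
move=> n1 x0 sh h0 hx vh mode.
have [r r1 /andP[]] := nat_sqrt n1; set s := Num.sqrt _ => rs sr.
have s2 : s ^+ 2 = n%:R by rewrite sqr_sqrtr ?ler0n.
move: mode; set M := h`_k * _ => mode.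
have sT := leq_trans (size_theta h) sh.
have sTT := leq_trans (size_theta _) sT.
have E0 := horner_coef_wide x sh.
have E1 := horner_coef_wide x sT.
have E2 := horner_coef_wide x sTT.
have T0 : 0 <= (theta h).[x].
  by rewrite E1 sumr_ge0 // => i _; rewrite coef_theta !mulr_ge0 ?exprn_ge0.
have TN : (theta h).[x] <= N%:R * h.[x].
  rewrite E1 E0 mulr_sumr ler_sum // => i _; rewrite coef_theta -mulrA.
  by rewrite ler_wpM2r ?mulr_ge0 ?exprn_ge0 // ler_nat -ltnS.
have [|c cu] := @nearest_nat N ((theta h).[x] / h.[x]).
  by rewrite divr_ge0 ?(ltW hx) //= ler_pdivrMr.
have W : r%:R ^+ 2 * h.[x] - ((theta (theta h)).[x] - 2 * c%:R * (theta h).[x]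
      + c%:R ^+ 2 * h.[x]) <= M * ((4 * r%:R ^+ 3 - r%:R) / 3).
  apply: le_trans (ler_wpM2l _ (sum_window r c N.+1)); last first.
    by rewrite (le_trans _ (mode 0%N)) // mulr_ge0 ?exprn_ge0.
  rewrite E0 E1 E2 !mulr_sumr -sumrB -big_split -sumrB /=; apply: ler_sum => j _.
  rewrite !coef_theta.
  apply: (@le_trans _ _ (h`_j * x ^+ j * (r ^ 2 - (j - c + (c - j)) ^ 2)%:R)).
    have -> : r%:R ^+ 2 * (h`_j * x ^+ j) - (j%:R * (j%:R * h`_j) * x ^+ j -
       2 * c%:R * (j%:R * h`_j * x ^+ j) + c%:R ^+ 2 * (h`_j * x ^+ j)) =
       h`_j * x ^+ j * (r%:R ^+ 2 - (j%:R - c%:R) ^+ 2) by ring.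
    apply: ler_wpM2l; first by rewrite mulr_ge0 ?exprn_ge0.
    have -> : (j%:R - c%:R : R) ^+ 2 = ((j - c + (c - j)) ^ 2)%:R.
      rewrite natrX; case: (leqP c j) => [|/ltnW] cj; rewrite (eqP cj).
        by rewrite addn0 natrB.
      by rewrite add0n natrB // -sqrrN opprB.
    rewrite -natrX; case: (leqP ((j - c + (c - j)) ^ 2) (r ^ 2)) => le.
      by rewrite natrB.
    rewrite (eqP (ltnW le)) subr_le0 ler_nat; exact: ltnW.
  by apply: ler_wpM2r.
move: vh; rewrite /var_le -s2.
(* The variance is the second moment about [c] minus the squared distance from [c] to the mean,
   which [cu] bounds by 1 / 4. *)
have -> : (theta (theta h)).[x] * h.[x] - (theta h).[x] ^+ 2 =
   h.[x] * ((theta (theta h)).[x] - 2 * c%:R * (theta h).[x] + c%:R ^+ 2 * h.[x]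
    - h.[x] * ((theta h).[x] / h.[x] - c%:R) ^+ 2).
  by field; rewrite gt_eqF.
rewrite [_ * h.[x] ^+ 2]mulrC expr2 -[_ * _ * (_ / _)]mulrA ler_pM2l // => vh.
have {}W : h.[x] * (r%:R ^+ 2 - s ^+ 2 / 8 - 1 / 4) <= M * ((4 * r%:R ^+ 3 - r%:R) / 3).
  by have := ler_wpM2l (ltW hx) cu; lra.
have M0 : 0 <= M by rewrite (le_trans _ (mode 0%N)) // mulr_ge0 ?exprn_ge0.
have r1' : 1 <= r%:R :> R by rewrite ler1n.
have key : 4 * r%:R ^+ 3 - r%:R <= 6 * s * (r%:R ^+ 2 - s ^+ 2 / 8 - 1 / 4).
  by have := @window_cubic r%:R (s - r%:R); rewrite subrKC; apply; lra.
have D0 : 0 < r%:R ^+ 2 - s ^+ 2 / 8 - 1 / 4.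
  rewrite -(@pmulr_rgt0 _ (6 * s)); last by lra.
  by apply: lt_le_trans key; have := exprn_ege1 2 r1'; nra.
rewrite -(ler_pM2r D0); apply: le_trans W _.
have := ler_wpM2l M0 key; lra.
Qed.
End Window.

(** * From logarithmic derivatives to coefficients *)

Section Compare.
Variable R : rcfType.

Lemma horner_ge0 (p : {poly R}) x : (forall k, 0 <= p`_k) -> 0 <= x -> 0 <= p.[x].
Proof.
by move=> p0 x0; rewrite horner_coef sumr_ge0 // => i _; rewrite mulr_ge0 ?exprn_ge0.
Qed.

Lemma ler_coef_horner (p : {poly R}) x k :
  (forall k, 0 <= p`_k) -> 0 <= x -> p`_k * x ^+ k <= p.[x].
Proof.
move=> p0 x0; rewrite (@horner_coef_wide _ (k.+1 + size p)%N) ?leq_addl //.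
have lt : (k < k.+1 + size p)%N by rewrite leq_addr.
rewrite (bigD1 (Ordinal lt)) //= lerDl sumr_ge0 // => i _.
by rewrite mulr_ge0 ?exprn_ge0.
Qed.

(* If [f.[l] = t * q.[l] ^+ m] with [1 < t], then [f - t q^m] is negative at 0
   and nonincreasing up to its first root, which is absurd. *)
Lemma ler_log_deriv (f q : {poly R}) (m : nat) :
    (forall x, 0 <= x -> 0 < q.[x]) -> (forall x, 0 <= x -> 0 <= q^`().[x]) ->
    f.[0] <= q.[0] ^+ m ->
    (forall x, 0 < x -> f^`().[x] * q.[x] <= m%:R * q^`().[x] * f.[x]) ->
  forall x, 0 <= x -> f.[x] <= q.[x] ^+ m.
Proof.
move=> q0 q'0 f0 f' l; rewrite le_eqVlt => /predU1P[<- // | l0].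
rewrite leNgt; apply/negP => lt.
have hl : 0 < q.[l] ^+ m by rewrite exprn_gt0 ?q0 ?ltW.
pose t := f.[l] / q.[l] ^+ m.
have t1 : 1 < t by rewrite ltr_pdivlMr // mul1r.
pose F := f - t *: q ^+ m.
have FE x : F.[x] = f.[x] - t * q.[x] ^+ m by rewrite !hornerE.
have F0 : F.[0] < 0.
  rewrite FE subr_lt0 (le_lt_trans f0) // ltr_pMl //.
  by rewrite exprn_gt0 ?q0.
have Fl : F.[l] = 0 by rewrite FE /t divfK ?subrr // gt_eqF.
have [y [y0 yl Fy noroot]] : exists y, [/\ 0 < y, y <= l, F.[y] = 0 &
    {in `]0, y[, forall z, ~~ root F z}].
  have := next_rootP F 0 l; case.
  - by move=> Fz; rewrite Fz horner0 ltxx in F0.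
  - by move=> y _ Fy; rewrite inE /= => /andP[y0 yl] nr; exists y; split; rewrite // ltW.
  - by move=> c _ _ nr; exists l; split.
have Fneg z : z \in `]0, y[ -> F.[z] <= 0.
  move=> zy; rewrite leNgt; apply/negP => Fz.
  move: (zy); rewrite in_itv /= => /andP[z0 zy'].
  have [|w] := @poly_ivtoo _ F 0 z (ltW z0); first by rewrite nmulr_rlt0.
  rewrite in_itv /= => /andP[w0 wz]; apply/negP/noroot.
  by rewrite in_itv /= w0 (lt_trans wz).
have [c cy] := poly_mvt F y0.
move: (cy); rewrite in_itv /= => /andP[c0 cy'].
rewrite Fy sub0r subr0 => E.
have : 0 < F^`().[c] * q.[c].
  by rewrite pmulr_lgt0 ?q0 ?ltW // -(pmulr_lgt0 _ y0) -E oppr_gt0.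
apply/negP; rewrite -leNgt.
have -> : F^`().[c] = f^`().[c] - t * (m%:R * (q^`().[c] * q.[c] ^+ m.-1)).
  by rewrite derivB derivZ deriv_exp hornerD hornerN hornerZ hornerMn hornerM horner_exp mulr_natl.
(* The hypothesis on f' together with the equality case for q^m gives F' q <= m q' F, and F is
   nonpositive before its first root. *)
apply: (@le_trans _ _ (m%:R * q^`().[c] * F.[c])); last first.
  by rewrite mulr_ge0_le0 ?Fneg // mulr_ge0 ?q'0 // ltW.
have qm : m%:R * (q.[c] * q.[c] ^+ m.-1) = m%:R * q.[c] ^+ m.
  by case: (m) => [|j]; rewrite ?mul0r //= exprS.
have := f' c c0; rewrite FE => f'c; rewrite mulrBl.
have -> : t * (m%:R * (q^`().[c] * q.[c] ^+ m.-1)) * q.[c] =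
  t * q^`().[c] * (m%:R * (q.[c] * q.[c] ^+ m.-1)) by ring.
by rewrite qm; lra.
Qed.

Lemma coef_le_sqrt_coefX (f q : {poly R}) (d m : nat) :
    (0 < d)%N -> (0 < m)%N -> (size q <= d.+1)%N ->
    (forall k, 0 <= f`_k) -> (forall k, 0 <= q`_k) ->
    (forall k, (k <= d)%N -> 0 < q`_k) -> tp2 q ->
    (forall x, 0 <= x -> var_le q x (d%:R / 4)) ->
    (forall x, 0 <= x -> f.[x] <= q.[x] ^+ m) ->
  forall k, f`_k <= 2 * Num.sqrt (2 * d * m)%:R * (q ^+ m)`_k.
Proof.
move=> d0 m0 sq f0 q0 qp tq vq fq k; set n := (2 * d * m)%N.
have n1 : (1 <= n)%N by rewrite !muln_gt0 d0.
have hge0 := coefX_ge0 m q0; have hpos := coefX_gt0 (m := m) q0 qp.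
have htp := tp2X m tq.
have hvar x : 0 <= x -> var_le (q ^+ m) x (n%:R / 8).
  move=> x0; have := var_leX m (vq x x0); rewrite /var_le => /le_trans; apply.
  by rewrite le_eqVlt /n !natrM; apply/predU1P; left; field.
have hsz : (size (q ^+ m) <= (m * d).+1)%N.
  apply: leq_trans (size_poly_exp_leq _ _) _; rewrite ltnS mulnC leq_mul //.
  by move: sq; case: (size q).
have fh x : 0 <= x -> f.[x] <= (q ^+ m).[x] by move=> x0; rewrite horner_exp fq.
move: hge0 hpos htp hvar hsz fh; set h := q ^+ m => hge0 hpos htp hvar hsz fh.
case: (leqP k (m * d)) => [kle | kgt]; last first.
  rewrite (leq_sizeP _ _ hsz) // mulr0 leNgt; apply/negP => fk.
  (* A positive coefficient of f beyond the degree of h would give f_k y^(md+1) <= f(y) <= h(y) <=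
     h(1) y^(md) for every y >= 1, hence f_k y <= h(1), which this y violates. *)
  pose y := 1 + h.[1] / f`_k.
  have y1 : 1 <= y by rewrite lerDl divr_ge0 ?horner_ge0 // ltW.
  have y0 : 0 <= y by lra.
  have : f`_k * y ^+ (m * d).+1 <= h.[1] * y ^+ (m * d).
    apply: (@le_trans _ _ (f`_k * y ^+ k)).
      by rewrite ler_pM2l // ler_weXn2l.
    apply: le_trans (ler_coef_horner k f0 y0) _; apply: le_trans (fh y y0) _.
    rewrite !(horner_coef_wide _ hsz) mulr_suml ler_sum // => i _.
    by rewrite expr1n mulr1 ler_wpM2l // ler_weXn2l // -ltnS.
  rewrite exprS mulrA ler_pM2r ?exprn_gt0 //; last by lra.
  by apply/negP; rewrite -ltNge /y mulrDr mulrCA divff ?gt_eqF // !mulr1 ltrDr.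
have s1 : 1 <= Num.sqrt (n%:R : R) by rewrite -[X in X <= _]sqrtr1 ler_sqrt ?ler1n.
(* The constant term has no predecessor from which to define x; it is compared at the point 0
   instead. *)
case: k kle => [|k] kle.
  apply: (@le_trans _ _ h`_0); first by rewrite -!horner_coef0 fh.
  by rewrite ler_peMl //; lra.
have pk := hpos k (ltnW kle); have pk1 := hpos k.+1 kle.
have mode := tp2_mode htp pk pk1; rewrite /= in mode.
move: mode; set x := h`_k / _ => mode.
have x0 : 0 < x by rewrite divr_gt0.
have hx : 0 < h.[x].
  apply: lt_le_trans (ler_coef_horner k hge0 (ltW x0)).
  by rewrite mulr_gt0 ?exprn_gt0.
have := max_coef_lower_bound n1 (ltW x0) hsz hge0 hx (hvar x (ltW x0)) mode.
move=> /(le_trans (fh x (ltW x0))) /(le_trans (ler_coef_horner k.+1 f0 (ltW x0))).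
by rewrite mulrA ler_pM2r // exprn_gt0.
Qed.

End Compare.

(** * Independent sets *)

Section Neighbours.
Variable G : sgraph.
Definition nb (v : G) : {set G} := [set y | adj v y].

Lemma nb_sym (u v : G) : (u \in nb v) = (v \in nb u).
Proof. by rewrite !inE adj_sym. Qed.

Lemma nb_irrefl (v : G) : v \notin nb v.
Proof. by rewrite inE adj_irrefl. Qed.
End Neighbours.

Section IndependentSets.
Variable G : sgraph.
Implicit Types (u v w : G) (A B F I J U W : {set G}).

Lemma independentP I :
  reflect {in I &, forall u v, u \notin nb v} (independent I).
Proof.
apply: (iffP forall_inP) => [h u v uI vI | h v vI].
  by rewrite inE; move/forall_inP: (h v vI); apply.
by apply/forall_inP => u uI; have := h u v uI vI; rewrite inE.
Qed.

Lemma independentS A B : A \subset B -> independent B -> independent A.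
Proof.
by move=> /subsetP sAB /independentP iB; apply/independentP => u v /sAB uB /sAB; apply: iB.
Qed.

Lemma independent0 : independent (set0 : {set G}).
Proof. by apply/independentP => u v; rewrite inE. Qed.

Lemma independent1 v : independent [set v].
Proof. by apply/independentP => u w /set1P-> /set1P->; rewrite nb_irrefl. Qed.

Definition unblocked J : {set G} := [set u | [disjoint nb u & J]].

Lemma independentU A B :
  independent (A :|: B) =
    [&& independent A, independent B & B \subset unblocked A].
Proof.
apply/idP/and3P => [iAB | [/independentP iA /independentP iB /subsetP BA]].
  split; [exact: independentS (subsetUl _ _) iAB | exact: independentS (subsetUr _ _) iAB |].
  apply/subsetP => v vB; rewrite inE disjoint_subset; apply/subsetP => u uv.
  rewrite inE; apply/negP => uA; move/independentP: iAB.
  by move/(_ u v); rewrite uv !inE uA vB orbT => /(_ isT isT).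
have AB u v : u \in A -> v \in B -> u \notin nb v.
  by move=> uA /BA; rewrite inE => /disjointFl ->.
apply/independentP => u v /setUP[uA|uB] /setUP[vA|vB]; [exact: iA | exact: AB | | exact: iB].
by rewrite nb_sym; apply: AB.
Qed.

(** The Markov property of the hard-core model: once the part [J] outside [W] is revealed, only
    adjacency to [J] restricts the part inside. *)
Lemma big_independent_split (K : nmodType) F W (phi : {set G} -> K) :
  \sum_(I : {set G} | independent I && (I \subset F)) phi I =
  \sum_(J : {set G} | independent J && (J \subset F :\: W))
   \sum_(B : {set G} | independent B && (B \subset F :&: W :&: unblocked J)) phi (J :|: B).
Proof.
rewrite pair_big_dep /=.
rewrite (reindex_onto (fun p : {set G} * {set G} => p.1 :|: p.2)
  (fun I => (I :\: W, I :&: W))) /=; last first.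
  by move=> I _; rewrite setUC setID.
apply: eq_bigl => -[J B] /=; rewrite independentU subUset xpair_eqE.
apply/idP/idP.
  case/andP => /andP[/and3P[-> -> BJ] /andP[JF BF]] /andP[/eqP EJ /eqP EB].
  rewrite -{1}EJ setSD ?subUset ?JF ?BF //= !subsetI BF BJ !andbT /=.
  by rewrite -EB subsetIr.
case/and3P => /andP[-> JFW] ->; rewrite !subsetI => /andP[/andP[-> BW] ->].
move: JFW; rewrite subsetD => /andP[-> JW] /=.
rewrite setDUl setIUl; have /setDidPl -> := JW.
move: (BW); rewrite -setD_eq0 => /eqP ->; have /setIidPl -> := BW.
by move: JW; rewrite -setI_eq0 => /eqP ->; rewrite setU0 set0U !eqxx.
Qed.

Lemma big_independent_setU1 (K : nmodType) v U (psi : {set G} -> K) : U \subset nb v ->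
  \sum_(B : {set G} | independent B && (B \subset v |: U)) psi B =
  psi [set v] + \sum_(B : {set G} | independent B && (B \subset U)) psi B.
Proof.
move=> /subsetP Uv; rewrite (bigD1 [set v]) /=; last first.
  by rewrite independent1 subsetUl.
congr (_ + _); apply: eq_bigl => B; rewrite -andbA; case: (boolP (independent B)) => //= iB.
apply/andP/idP => [[/subsetP BvU nB] | BU]; last first.
  split; first exact: subset_trans BU (subsetUr _ _).
  apply: contraTneq BU => ->; rewrite sub1set; apply/negP => /Uv.
  by rewrite (negPf (nb_irrefl v)).
have vB : v \notin B.
  apply: contra nB => vB; rewrite eqEsubset sub1set vB andbT.
  apply/subsetP => w wB; have /setU1P[->|/Uv wv] := BvU w wB; first exact: set11.
  by move/independentP: iB => /(_ w v wB vB); rewrite wv.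
apply/subsetP => w wB; have /setU1P[wv|//] := BvU w wB.
by rewrite -wv wB in vB.
Qed.

Section IndepPoly.
Variables (A : comNzRingType) (x : A).

(** The ring is arbitrary so that the same sum serves as a polynomial, at ['X], and as its value at
    a point. *)
Definition indep_sum F := \sum_(I : {set G} | independent I && (I \subset F)) x ^+ #|I|.

Definition indep_size_sum F :=
  \sum_(I : {set G} | independent I && (I \subset F)) x ^+ #|I| *+ #|I|.

Definition independent_away v J := independent J && (J \subset ~: (v |: nb v)).

(** The local configuration at [v]: after [J] is revealed, what remains is either [v] alone or an
    independent subset of this set. The vertex [v] is never blocked, since [J] avoids its
    neighbours. *)
Definition free_nb v J := nb v :&: unblocked J.

Lemma big_independent_nb (K : nmodType) v (phi : {set G} -> K) :
  \sum_(I | independent I) phi I =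
  \sum_(J | independent_away v J) (phi (v |: J) +
     \sum_(B : {set G} | independent B && (B \subset free_nb v J)) phi (J :|: B)).
Proof.
transitivity (\sum_(I : {set G} | independent I && (I \subset setT)) phi I).
  by apply: eq_bigl => I; rewrite subsetT andbT.
rewrite (big_independent_split _ (v |: nb v)) setTD setTI.
apply: eq_bigr => J /andP[iJ Jv].
have -> : (v |: nb v) :&: unblocked J = v |: free_nb v J.
  rewrite setIUl; congr (_ :|: _); apply/setIidPl; rewrite sub1set inE.
  rewrite disjoint_sym disjoints_subset; apply: subset_trans Jv _.
  by rewrite setCS subsetUr.
by rewrite big_independent_setU1 ?subsetIl // [J :|: _]setUC.
Qed.

Lemma card_unblocked_setU v J B : independent_away v J ->
    B \subset nb v ->
  [/\ #|v |: J| = #|J|.+1, #|J :|: B| = (#|J| + #|B|)%N,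
      (v |: J) :&: nb v = set0 & (J :|: B) :&: nb v = B].
Proof.
move=> /andP[_]; rewrite -disjoints_subset => dJ BU.
have vJ : v \notin J by apply/negP => /(disjointFr dJ); rewrite setU11.
have Jnb : J :&: nb v = set0.
  by apply/eqP; rewrite setI_eq0; apply: disjointWr dJ; rewrite subsetUr.
split.
- by rewrite cardsU1 vJ.
- rewrite cardsU (_ : J :&: B = set0) ?cards0 ?subn0 //.
  by apply/eqP; rewrite -subset0 -Jnb setIS.
- rewrite setIUl Jnb setU0; apply/eqP; rewrite setI_eq0.
  by rewrite disjoints1 nb_irrefl.
- by rewrite setIUl Jnb set0U; apply/setIidPl.
Qed.

Lemma indep_sumT v : indep_sum setT =
  \sum_(J | independent_away v J) x ^+ #|J| * (x + indep_sum (free_nb v J)).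
Proof.
transitivity (\sum_(I : {set G} | independent I) x ^+ #|I|).
  by apply: eq_bigl => I; rewrite subsetT andbT.
rewrite (big_independent_nb v); apply: eq_bigr => J vJ.
have [-> _ _ _] := card_unblocked_setU vJ (sub0set _).
rewrite mulrDr -exprSr; congr (_ + _); rewrite mulr_sumr; apply: eq_bigr => B /andP[_].
rewrite subsetI => /andP[Bv _]; have [_ -> _ _] := card_unblocked_setU vJ Bv.
by rewrite exprD.
Qed.

Lemma indep_sum_mem v :
  \sum_(I : {set G} | independent I) x ^+ #|I| *+ (v \in I) =
  \sum_(J | independent_away v J) x ^+ #|J| * x.
Proof.
rewrite (big_independent_nb v); apply: eq_bigr => J vJ.
have [-> _ _ _] := card_unblocked_setU vJ (sub0set _).
rewrite setU11 exprSr big1 ?addr0 // => B /andP[_].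
rewrite subsetI => /andP[Bv _]; case/andP: vJ => _ /subsetP Jv.
have vJ : v \notin J by apply/negP => /Jv; rewrite in_setC setU11.
have vB : v \notin B by apply: contra (nb_irrefl v) => /(subsetP Bv).
by rewrite in_setU (negPf vJ) (negPf vB).
Qed.

Lemma indep_sum_nb v :
  \sum_(I : {set G} | independent I) x ^+ #|I| *+ #|I :&: nb v| =
  \sum_(J | independent_away v J) x ^+ #|J| * indep_size_sum (free_nb v J).
Proof.
rewrite (big_independent_nb v); apply: eq_bigr => J vJ.
have [_ _ -> _] := card_unblocked_setU vJ (sub0set _).
rewrite cards0 mulr0n add0r mulr_sumr; apply: eq_bigr => B /andP[_].
rewrite subsetI => /andP[Bv _]; have [_ -> _ ->] := card_unblocked_setU vJ Bv.
by rewrite exprD mulrnAr.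
Qed.

Lemma sum_indep_sum_mem :
  \sum_v \sum_(J | independent_away v J) x ^+ #|J| * x = indep_size_sum setT.
Proof.
under eq_bigr => v _ do rewrite -indep_sum_mem.
rewrite exchange_big /= /indep_size_sum.
rewrite [RHS](eq_bigl (@independent G)) => [|I]; last by rewrite subsetT andbT.
apply: eq_bigr => I _; rewrite -sum1_card -sumrMnr [RHS]big_mkcond /=.
by apply: eq_bigr => v _; case: (v \in I).
Qed.

(** The consistency constraint of the linear program: each vertex of an independent set is a
    neighbour of exactly [d] vertices. *)
Lemma sum_indep_sum_nb d : regular G d ->
  \sum_v \sum_(J | independent_away v J) x ^+ #|J| * indep_size_sum (free_nb v J)
  = indep_size_sum setT *+ d.
Proof.
move=> reg; under eq_bigr => v _ do rewrite -indep_sum_nb.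
rewrite exchange_big /= /indep_size_sum -sumrMnl.
rewrite [RHS](eq_bigl (@independent G)) => [|I]; last by rewrite subsetT andbT.
apply: eq_bigr => I _; rewrite -mulrnA sumrMnr; congr (_ *+ _).
transitivity (\sum_v \sum_(w in I) (w \in nb v))%N.
  apply: eq_bigr => v _; rewrite -sum1_card [RHS]big_mkcond [LHS]big_mkcond /=.
  by apply: eq_bigr => w _; rewrite inE; do 2!case: (_ \in _).
rewrite exchange_big /= -sum_nat_const; apply: eq_bigr => w _.
rewrite -(reg w) -sum1_card [RHS]big_mkcond; apply: eq_bigr => v _.
by rewrite nb_sym; case: (v \in nb w).
Qed.

End IndepPoly.

Definition indep_count U k := #|[set B : {set G} | [&& independent B, B \subset U & #|B| == k]]|.

(** Counts pairs of an independent set of size k + 1 and one of its elements: deleting the element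
    leaves a set of size k, which arises from at most |U| - k elements. *)
Lemma indep_count_succ U k :
  (k.+1 * indep_count U k.+1 <= (#|U| - k) * indep_count U k)%N.
Proof.
rewrite /indep_count mulnC [leqRHS]mulnC -2!sum_nat_const.
pose P (B : {set G}) := [&& independent B, B \subset U & #|B| == k].
apply: (@leq_trans (\sum_(B | P B) \sum_(v | v \in U :\: B) 1)); last first.
  rewrite [leqRHS](eq_bigl P) => [|B]; last by rewrite inE.
  apply: leq_sum => B /and3P[_ BU /eqP <-].
  by rewrite sum1_card cardsD (setIidPr BU).
rewrite (exchange_big_dep predT) //=.
rewrite (eq_bigl (fun B : {set G} => [&& independent B, B \subset U & #|B| == k.+1]));
  last by move=> B; rewrite inE.
apply: (@leq_trans (\sum_(B : {set G} | [&& independent B, B \subset U & #|B| == k.+1])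
   \sum_(v in B) 1)%N).
  by apply: leq_sum => B /and3P[_ _ /eqP <-]; rewrite sum1_card.
rewrite (exchange_big_dep predT) //=; apply: leq_sum => v _.
rewrite (reindex_onto (fun B => v |: B) (fun B => B :\ v)) /=; last first.
  by move=> B /andP[_ vB]; rewrite setD1K.
rewrite [leqLHS]big_mkcond [leqRHS]big_mkcond; apply: leq_sum => B _.
case: ifP => // /andP[/andP[/and3P[iB BU cB] _] /eqP E].
have vB : v \notin B by rewrite -E !inE eqxx.
move: BU cB; rewrite subUset sub1set cardsU1 vB eqSS => /andP[vU BU] /eqP cB.
rewrite ifT // /P BU cB eqxx (independentS (subsetUr _ _) iB) /=.
by rewrite inE vB.
Qed.

End IndependentSets.

(** * Occupancy bound for independent sets *)

Section IndepOccupancy.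
Variable R : rcfType.

Lemma sum_bin_pow (A : comNzRingType) (d : nat) (x : A) :
  \sum_(k < d.+1) 'C(d, k)%:R * x ^+ k = (1 + x) ^+ d.
Proof. by rewrite exprDn; apply: eq_bigr => k _; rewrite expr1n mul1r mulr_natl. Qed.

Lemma indep_sum_count (A : comNzRingType) (G : sgraph) (x : A) (U : {set G}) d : (#|U| <= d)%N ->
  indep_sum x U = \sum_(k < d.+1) (indep_count U k)%:R * x ^+ k.
Proof.
move=> Ud; rewrite /indep_sum.
rewrite (partition_big (fun B : {set G} => inord #|B| : 'I_d.+1) predT) //=.
apply: eq_bigr => k _; rewrite mulr_natl -sumr_const.
apply: eq_big => [B | B /andP[/andP[_ BU] /eqP <-]].
  rewrite inE -andbA; case: (independent B) => //=.
  case: (boolP (B \subset U)) => //= BU; rewrite -val_eqE /= inordK //.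
  by rewrite ltnS (leq_trans (subset_leq_card BU)).
by rewrite inordK // ltnS (leq_trans (subset_leq_card BU)).
Qed.

Lemma indep_size_sum_count (G : sgraph) (x : R) (U : {set G}) d : (#|U| <= d)%N ->
  indep_size_sum x U = \sum_(k < d.+1) k%:R * (indep_count U k)%:R * x ^+ k.
Proof.
move=> Ud; rewrite /indep_size_sum.
rewrite (partition_big (fun B : {set G} => inord #|B| : 'I_d.+1) predT) //=.
apply: eq_bigr => k _; rewrite -mulrA mulr_natl [_ * x ^+ k]mulr_natl -sumr_const -sumrMnl.
apply: eq_big => [B | B /andP[/andP[_ BU] /eqP <-]].
  rewrite inE -andbA; case: (independent B) => //=.
  case: (boolP (B \subset U)) => //= BU; rewrite -val_eqE /= inordK //.
  by rewrite ltnS (leq_trans (subset_leq_card BU)).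
by rewrite inordK // ltnS (leq_trans (subset_leq_card BU)).
Qed.

Lemma indep_count0 (G : sgraph) (U : {set G}) : indep_count U 0 = 1%N.
Proof.
rewrite -(cards1 (set0 : {set G})); apply: eq_card => B; rewrite !inE.
by rewrite cards_eq0; case: eqVneq => [->|]; rewrite ?andbF // independent0 sub0set.
Qed.

(* Conditioned on being nonempty, the hard-core model on a graph with at most [d]
   vertices has the largest mean size when the graph is [d] isolated vertices. *)
Lemma indep_size_sum_le (G : sgraph) (x : R) (U : {set G}) d :
    (#|U| <= d)%N -> (0 < d)%N -> 0 <= x ->
  indep_size_sum x U * ((1 + x) ^+ d - 1) <=
    d%:R * x * (1 + x) ^+ d.-1 * (indep_sum x U - 1).
Proof.
case: d => // d Ud _ x0.
(* The ratio to the graph of isolated vertices; [indep_count_succ] makes it nonincreasing. Past the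
   last size the binomial coefficient and its inverse are 0, so the ratio is 0. *)
pose r k : R := (indep_count U k)%:R / 'C(d.+1, k)%:R.
have rE (k : 'I_d.+1) : 'C(d.+1, k.+1)%:R * r k.+1 = (indep_count U k.+1)%:R.
  by rewrite mulrC divfK // pnatr_eq0 -lt0n bin_gt0.
have rd : {homo r : i j / (i <= j)%N >-> j <= i}.
  apply: (@homo_leq _ _ (fun a b => b <= a)) => [y | b a c ab bc | k] //.
    exact: le_trans bc ab.
  rewrite /r; case: (ltnP k d.+1) => kd; last first.
    by rewrite (@bin_small _ k.+1) // invr0 mulr0 divr_ge0.
  rewrite ler_pdivrMr ?ltr0n ?bin_gt0 // mulrAC ler_pdivlMr ?ltr0n ?bin_gt0 1?ltnW //.
  rewrite -(@ler_pM2l _ k.+1%:R) ?ltr0n // -!natrM ler_nat.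
  have e1 := mul_bin_left d.+1 k; have e2 := indep_count_succ U k.
  have e3 : ((#|U| - k) * indep_count U k <= (d.+1 - k) * indep_count U k)%N.
    by rewrite leq_mul2r leq_sub2r ?orbT.
  rewrite [leqRHS]mulnCA e1 !mulnA leq_mul // [leqRHS]mulnC.
  exact: leq_trans e2 e3.
(* The shift by one drops the empty set. *)
pose w (k : 'I_d.+1) := 'C(d.+1, k.+1)%:R * x ^+ k.+1.
have Ew : \sum_k w k = (1 + x) ^+ d.+1 - 1.
  rewrite -sum_bin_pow [in RHS]big_ord_recl bin0 mul1r expr0 addrC addKr.
  exact: eq_bigr.
have Ewg : \sum_k w k * k.+1%:R = d.+1%:R * x * (1 + x) ^+ d.
  rewrite -sum_bin_pow mulr_sumr; apply: eq_bigr => k _.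
  rewrite /w exprS mulrAC -natrM mulnC -mul_bin_diag natrM; ring.
have Ewf : \sum_k w k * r k.+1 = indep_sum x U - 1.
  rewrite (indep_sum_count _ Ud) [in RHS]big_ord_recl indep_count0 mul1r expr0 addrC addKr.
  by apply: eq_bigr => k _; rewrite /w mulrAC rE.
have Ewfg : \sum_k w k * r k.+1 * k.+1%:R = indep_size_sum x U.
  rewrite (indep_size_sum_count _ Ud) [in RHS]big_ord_recl !mul0r add0r.
  by apply: eq_bigr => k _; rewrite lift0 /w [_ * r _]mulrAC rE; ring.
rewrite mulrC -Ew -Ewfg [X in _ <= X]mulrC -Ewf -Ewg.
apply: chebyshev_sum => [k | i j]; first by rewrite mulr_ge0 ?exprn_ge0.
case: (leqP i j) => [|/ltnW] ij.
  by rewrite mulr_ge0_le0 ?subr_ge0 ?subr_le0 ?rd ?ler_nat.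
by rewrite mulr_le0_ge0 ?subr_ge0 ?subr_le0 ?rd ?ler_nat.
Qed.

Definition indep_poly (G : sgraph) : {poly R} := indep_sum 'X [set: G].

Lemma coef_indep_poly (G : sgraph) k : (indep_poly G)`_k = (num_indep G k)%:R.
Proof.
rewrite /indep_poly /indep_sum coef_sum /num_indep -sum1_card natr_sum.
rewrite [LHS]big_mkcond [RHS]big_mkcond /=; apply: eq_bigr => I _.
rewrite inE subsetT andbT coefXn eq_sym.
by case: (independent I); case: eqP.
Qed.

Lemma horner_indep_poly (G : sgraph) x : (indep_poly G).[x] = indep_sum x [set: G].
Proof. by rewrite horner_sum; apply: eq_bigr => I _; rewrite hornerXn. Qed.

Lemma horner_theta_indep_poly (G : sgraph) x :
  x * (indep_poly G)^`().[x] = indep_size_sum x [set: G].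
Proof.
rewrite /indep_poly /indep_sum raddf_sum horner_sum mulr_sumr; apply: eq_bigr => I _.
rewrite /= derivXn hornerMn hornerXn mulrnAr -exprS.
by case: #|I|.
Qed.

Definition bip_indep_poly (d : nat) : {poly R} := (1 + 'X) ^+ d *+ 2 - 1.

Lemma horner_bip_indep_poly d x : (bip_indep_poly d).[x] = 2 * (1 + x) ^+ d - 1.
Proof. by rewrite !hornerE mulr_natl. Qed.

Lemma horner_deriv_bip_indep_poly d x :
  (bip_indep_poly d)^`().[x] = 2 * d%:R * (1 + x) ^+ d.-1.
Proof.
rewrite derivB derivMn deriv_exp derivD derivX !derivC add0r subr0 mul1r.
by rewrite !hornerMn !hornerE -mulrA !mulr_natl.
Qed.

(* Dual certificate: [Q + E P_U' / d <= B (x + P_U) + E] for each local graph [U],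
   with [B = (1 + x)^(d-1)], [E = (1 + x)^d - 1] and [Q = 2 (1 + x)^d - 1]. *)
Lemma indep_occupancy (G : sgraph) d x : (0 < d)%N -> regular G d -> 0 < x ->
  2 * (indep_poly G)^`().[x] * (bip_indep_poly d).[x] <=
    #|G|%:R * (2 * (1 + x) ^+ d.-1) * (indep_poly G).[x].
Proof.
move=> d0 reg x0; set f' := _^`().[x]; rewrite horner_bip_indep_poly horner_indep_poly.
set B := (1 + x) ^+ d.-1; set E := (1 + x) ^+ d - 1; set P := indep_sum x setT.
have EB : (1 + x) ^+ d = (1 + x) * B by rewrite /B; case: (d) d0 => // k _; rewrite exprS.
have d0' : 0 < d%:R :> R by rewrite ltr0n.
pose S := \sum_(v : G) \sum_(J | independent_away v J) x ^+ #|J|.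
pose S' := \sum_(v : G) \sum_(J | independent_away v J) x ^+ #|J| * indep_size_sum x (free_nb v J).
have ES : S * x = x * f'.
  rewrite horner_theta_indep_poly -sum_indep_sum_mem mulr_suml.
  by apply: eq_bigr => v _; rewrite mulr_suml.
have ES' : S' = d%:R * (x * f').
  by rewrite horner_theta_indep_poly /S' (sum_indep_sum_nb _ reg) mulr_natl.
have EP : #|G|%:R * P = \sum_(v : G) \sum_(J | independent_away v J)
    x ^+ #|J| * (x + indep_sum x (free_nb v J)).
  rewrite -(eq_bigr _ (fun v _ => indep_sumT x v)).
  by rewrite sumr_const mulr_natl.
(* The certificate, multiplied by d x and summed with weight x^|J|. It is tight when no neighbour is
   free and when all d are free and pairwise nonadjacent, the only two cases in K_{d,d}. *)
have main : (2 * (1 + x) ^+ d - 1 - E) * S * (d%:R * x) + E * S' <=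
    B * (d%:R * x) * (#|G|%:R * P).
  rewrite EP /S /S' !(mulr_sumr, mulr_suml) -big_split; apply: ler_sum => v _ /=.
  rewrite !(mulr_sumr, mulr_suml) -big_split; apply: ler_sum => J _ /=.
  have le : (#|free_nb v J| <= d)%N.
    by rewrite -(reg v) subset_leq_card // subsetIl.
  have := indep_size_sum_le le d0 (ltW x0); rewrite -/E -/B.
  move=> /(ler_wpM2l (exprn_ge0 #|J| (ltW x0))).
  by rewrite /E EB; lra.
have fS : f' = S by apply: (mulIf (lt0r_neq0 x0)); rewrite ES mulrC.
rewrite -(ler_pM2r (mulr_gt0 d0' x0)).
move: main; rewrite ES' fS; lra.
Qed.

End IndepOccupancy.

(** * Disjoint copies of complete bipartite graphs *)

Definition separated (G : sgraph) (A B : {set G}) :=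
  [disjoint A & B] && [forall u in A, [disjoint nb u & B]].

Definition joined (G : sgraph) (A B : {set G}) :=
  [/\ {in A & B, forall u v, v \in nb u}, independent A & independent B].

Section Copies.
Variables (m : nat) (K : sgraph).

Definition layer (i : 'I_m) : {set copies m K} := [set p : copies m K | p.1 == i].

(** Layers are added one at a time, each separated from the union of those below. The abstract [z]
    lets independent sets and matchings share the argument. *)
Lemma multiplicative_copies (A : comNzRingType) (z : {set copies m K} -> A) (q : A) :
    z set0 = 1 ->
    (forall F1 F2, separated F1 F2 -> z (F1 :|: F2) = z F1 * z F2) ->
    (forall i, z (layer i) = q) ->
  z setT = q ^+ m.
Proof.
move=> z0 zM zq.
have E k : (k <= m)%N -> z [set p : copies m K | p.1 < k]%N = q ^+ k.
  elim: k => [|k IH] km.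
    by rewrite -[RHS]z0; congr z; apply/setP => p; rewrite !inE.
  rewrite exprSr -(IH (ltnW km)) -(zq (Ordinal km)) -zM; last first.
    apply/andP; split.
      rewrite -setI_eq0; apply/eqP/setP => p; rewrite !inE -val_eqE /=; lia.
    apply/forall_inP => u; rewrite inE => uk; rewrite -setI_eq0; apply/eqP/setP => p.
    rewrite !inE /= /copies_adj -!val_eqE /=; apply/negP => /andP[/andP[/eqP up _] /eqP pk].
    by move: uk; rewrite up pk ltnn.
  by congr z; apply/setP => p; rewrite !inE -val_eqE /= ltnS leq_eqVlt orbC.
rewrite -(E m) //; congr z; apply/setP => p; rewrite !inE; exact/esym/ltn_ord.
Qed.

End Copies.

Section BipartiteLayer.
Variables (m d : nat) (i : 'I_m).
Let X := copies m (complete_bipartite d d).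

Definition left_part : {set X} := [set ((i, inl a) : X) | a in 'I_d].
Definition right_part : {set X} := [set ((i, inr a) : X) | a in 'I_d].

Lemma layer_bip : @layer m (complete_bipartite d d) i = left_part :|: right_part.
Proof.
apply/setP => -[j [a|a]]; rewrite !inE /=; apply/eqP/orP => [-> | ].
- by left; apply: imset_f.
- by case=> /imsetP[b _ []].
- by right; apply: imset_f.
- by case=> /imsetP[b _ []].
Qed.

Lemma card_left_part : #|left_part| = d.
Proof. by rewrite card_imset ?card_ord // => a b []. Qed.

Lemma card_right_part : #|right_part| = d.
Proof. by rewrite card_imset ?card_ord // => a b []. Qed.

Lemma joined_parts : joined left_part right_part.
Proof.
split; first by move=> u v /imsetP[a _ ->] /imsetP[b _ ->]; rewrite inE /= /copies_adj eqxx.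
  by apply/independentP => u v /imsetP[a _ ->] /imsetP[b _ ->]; rewrite inE /= /copies_adj andbF.
by apply/independentP => u v /imsetP[a _ ->] /imsetP[b _ ->]; rewrite inE /= /copies_adj andbF.
Qed.

End BipartiteLayer.

Section IndepExtremal.
Variables (A : comNzRingType) (x : A).

Lemma indep_sum0 (G : sgraph) : indep_sum x (set0 : {set G}) = 1.
Proof.
rewrite /indep_sum (big_pred1 set0) ?cards0 // => I; rewrite subset0.
by apply/andP/eqP => [[_ /eqP] | ->] //; rewrite independent0 eqxx.
Qed.

Lemma indep_sumU (G : sgraph) (F1 F2 : {set G}) :
  separated F1 F2 -> indep_sum x (F1 :|: F2) = indep_sum x F1 * indep_sum x F2.
Proof.
move=> /andP[dis /forall_inP sep].
rewrite /indep_sum (big_independent_split _ F1) mulrC mulr_suml.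
have -> : (F1 :|: F2) :\: F1 = F2.
  by rewrite setDUl setDv set0U; apply/setDidPl; rewrite disjoint_sym.
apply: eq_bigr => J /andP[_ JF]; rewrite mulr_sumr.
have -> : (F1 :|: F2) :&: F1 :&: unblocked J = F1.
  rewrite setUK; apply/setIidPl/subsetP => u uF; rewrite inE.
  exact: disjointWr JF (sep u uF).
apply: eq_bigr => B /andP[_ BF]; rewrite -exprD cardsU.
rewrite (_ : J :&: B = set0) ?cards0 ?subn0 //.
apply/eqP; rewrite setI_eq0 disjoint_sym.
exact: disjointWl BF (disjointWr JF dis).
Qed.

Lemma indep_sum_independent (G : sgraph) (F : {set G}) :
  independent F -> indep_sum x F = (1 + x) ^+ #|F|.
Proof.
move=> iF; rewrite (indep_sum_count _ (leqnn _)) -sum_bin_pow.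
apply: eq_bigr => k _; congr (_%:R * _); rewrite /indep_count -cards_draws.
apply: eq_card => B; rewrite !inE; case: (boolP (B \subset F)) => //= BF; last by rewrite andbF.
by rewrite (independentS BF iF).
Qed.

(** A nonempty choice in one part blocks the whole other part, so an independent set lies on one
    side; the empty set is counted twice. *)
Lemma indep_sum_joined (G : sgraph) (F1 F2 : {set G}) : joined F1 F2 ->
  indep_sum x (F1 :|: F2) = (1 + x) ^+ #|F1| + (1 + x) ^+ #|F2| - 1.
Proof.
move=> [adj12 i1 i2].
have F12 : (F1 :|: F2) :\: F1 = F2.
  rewrite setDUl setDv set0U; apply/setDidPl; rewrite -setI_eq0; apply/eqP/setP => u.
  rewrite !inE; apply/negP => /andP[u2 u1].
  by have := adj12 u u u1 u2; rewrite (negPf (nb_irrefl u)).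
rewrite /indep_sum (big_independent_split _ F1) F12 (bigD1 set0) ?independent0 ?sub0set //=.
rewrite -!indep_sum_independent // [X in _ = _ + X - _](bigD1 set0) ?independent0 ?sub0set //=.
rewrite cards0 expr0 [X in _ = _ + X - _]addrC addrA addrK; congr (_ + _).
  have -> : (F1 :|: F2) :&: F1 :&: unblocked set0 = F1.
    rewrite setUK; apply/setIidPl/subsetP => u _; rewrite inE; by rewrite -setI_eq0 setI0.
  by apply: eq_bigr => B _; rewrite set0U.
apply: eq_bigr => J /andP[/andP[_ JF] /set0Pn[w wJ]].
have -> : (F1 :|: F2) :&: F1 :&: unblocked J = set0.
  rewrite setUK; apply/setP => u; rewrite !inE; apply/negP => /andP[uF].
  by move/disjointFl => /(_ w wJ); rewrite adj12 // (subsetP JF).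
rewrite (big_pred1 set0) ?setU0 // => B; rewrite subset0.
by apply/andP/eqP => [[_ /eqP] | ->] //; rewrite independent0 eqxx.
Qed.

End IndepExtremal.

Section IndepBound.
Variable R : rcfType.

Lemma indep_poly_H d n : indep_poly R (H d n) = bip_indep_poly R d ^+ (n %/ (2 * d)).
Proof.
apply: multiplicative_copies => [| F1 F2 | i]; [exact: indep_sum0 | exact: indep_sumU |].
rewrite layer_bip (indep_sum_joined _ (joined_parts _ _)) card_left_part card_right_part.
by rewrite /bip_indep_poly mulr2n.
Qed.

Lemma coef_bip_indep_poly d k : (bip_indep_poly R d)`_k = 'C(d, k)%:R * (if k is 0 then 1 else 2).
Proof.
rewrite /bip_indep_poly coefB coefMn coef1 -sum_bin_pow coef_sum.
have -> : \sum_(i < d.+1) ('C(d, i)%:R * 'X^i)`_k = 'C(d, k)%:R :> R.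
  case: (ltnP k d.+1) => kd.
    rewrite (bigD1 (Ordinal kd)) //= -polyC_natr coefCM coefXn eqxx mulr1 big1 ?addr0 //.
    by move=> i; rewrite -val_eqE /= eq_sym -polyC_natr coefCM coefXn => /negPf->; rewrite mulr0.
  rewrite bin_small // big1 // => i _; rewrite -polyC_natr coefCM coefXn.
  by rewrite (_ : (k == i) = false) ?mulr0 //; have := ltn_ord i; lia.
case: k => [|k]; first by rewrite bin0 mulr1 mulr2n addrK.
by rewrite subr0 mulr_natr.
Qed.

Lemma ultra_log_concave_tp2 d (p : {poly R}) (b : nat -> R) :
    (forall k, 0 <= p`_k) -> (forall k, 0 <= b k) ->
    {homo b : i j / (i <= j)%N >-> j <= i} ->
    (forall k, k.+1%:R * p`_k.+1 = b k * ((d%:R - k%:R) * p`_k)) ->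
    (forall k, (d < k)%N -> p`_k = 0) -> tp2 p.
Proof.
move=> p0 b0 bd pS pd.
(* Truncated subtraction makes the ratio vanish from k = d on, in agreement with the zero
   coefficients. *)
apply: (@tp2_ratio _ _ (fun k => b k * (d - k)%:R / k.+1%:R)) => // [k | k | i j ij].
- apply: (@mulfI _ k.+1%:R); first by rewrite pnatr_eq0.
  rewrite pS; case: (leqP k d) => kd; last by rewrite pd // !mulr0.
  by rewrite natrB // [RHS]mulrA [k.+1%:R * _]mulrC divfK ?pnatr_eq0 // mulrA.
- by rewrite divr_ge0 ?mulr_ge0.
apply: ler_pM; rewrite ?mulr_ge0 ?invr_ge0 //.
  by apply: ler_pM; rewrite ?bd // ler_nat leq_sub2l.
by rewrite lef_pV2 ?posrE ?ltr0n // ler_nat.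
Qed.

Lemma indep_bound (d n k : nat) (G : sgraph) :
    (0 < d)%N -> (0 < n)%N -> (2 * d %| n)%N -> #|G| = n -> regular G d ->
  (num_indep G k)%:R <= 2 * Num.sqrt (n%:R : R) * (num_indep (H d n) k)%:R.
Proof.
move=> d0 n0 dn cG reg; set m := (n %/ (2 * d))%N.
have nE : n = (2 * d * m)%N by rewrite mulnC divnK.
have m0 : (0 < m)%N by move: n0; rewrite nE !muln_gt0 => /andP[].
have pge0 j : 0 <= (bip_indep_poly R d)`_j.
  by rewrite coef_bip_indep_poly; case: j => *; rewrite mulr_ge0.
have psz : (size (bip_indep_poly R d) <= d.+1)%N.
  by apply/leq_sizeP => j jd; rewrite coef_bip_indep_poly bin_small ?mul0r.
(* All coefficients except the constant one are doubled binomials, so only the first ratio differs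
   from the binomial one. *)
pose b j : R := if j is 0%N then 2 else 1.
have pS j : j.+1%:R * (bip_indep_poly R d)`_j.+1 =
    b j * ((d%:R - j%:R) * (bip_indep_poly R d)`_j).
  rewrite !coef_bip_indep_poly mulrA -natrM mul_bin_left natrM.
  case: (leqP j d) => jd; last by rewrite (bin_small jd) !(mul0r, mulr0).
  by rewrite natrB //; case: j {jd} => [|j] /=; ring.
have b0 j : 0 <= b j by case: j.
have bd : {homo b : i j / (i <= j)%N >-> j <= i}.
  by case=> [|i] [|j] //= _; rewrite /b; lra.
rewrite -!coef_indep_poly indep_poly_H -/m [X in Num.sqrt X%:R]nE.
apply: coef_le_sqrt_coefX => // [j | j jd | | x x0 | x x0].
- by rewrite coef_indep_poly.
- by rewrite coef_bip_indep_poly mulr_gt0 ?ltr0n ?bin_gt0 //; case: j {jd}.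
- apply: (@ultra_log_concave_tp2 d _ b) => // j jd.
  by rewrite coef_bip_indep_poly bin_small ?mul0r.
- exact: ultra_log_concave_var pS bd.
apply: ler_log_deriv x0 => {x} [x x0 | x x0 | | x x0].
- rewrite horner_bip_indep_poly.
  have : 1 <= (1 + x) ^+ d by rewrite exprn_ege1 // lerDl.
  by lra.
- by rewrite horner_deriv_bip_indep_poly !mulr_ge0 ?exprn_ge0 // addr_ge0.
- rewrite horner_bip_indep_poly addr0 expr1n horner_coef0.
  rewrite coef_indep_poly (_ : num_indep G 0 = indep_count [set: G] 0).
    by rewrite indep_count0; rewrite (_ : 2 * 1 - 1 = 1 :> R) ?expr1n //; ring.
  by apply: eq_card => B; rewrite !inE subsetT.
have := indep_occupancy d0 reg x0; rewrite cG nE horner_deriv_bip_indep_poly !natrM.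
lra.
Qed.

End IndepBound.

(** * Matchings *)

Section Matchings.
Variable G : sgraph.
Implicit Types (u v w : G) (F S : {set G}) (L M N : {set {set G}}).

Definition matching_in F M := matching M && (cover M \subset F).

Lemma matching_inD1 F w M :
  matching_in (F :\ w) M = matching_in F M && (w \notin cover M).
Proof. by rewrite /matching_in subsetD1 andbA. Qed.

Lemma edgesP (e : {set G}) :
  reflect (exists u, exists2 v, v \in nb u & e = [set u; v]) (e \in edges G).
Proof.
apply: (iffP imsetP) => [[[u v] uv ->] | [u [v uv ->]]].
  by exists u, v => //; move: uv; rewrite !inE.
by exists (u, v) => //; move: uv; rewrite !inE.
Qed.

Lemma matchingU1 v w N : w \in nb v -> matching_in (~: [set v; w]) N ->
  matching ([set v; w] |: N) /\ [set v; w] \notin N.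
Proof.
move=> vw /andP[/andP[NE tN] cN].
have [] := @trivIsetU1 _ [set v; w] N.
- move=> B BN; rewrite disjoint_sym disjoints_subset; apply: subset_trans cN.
  exact: (bigcup_max B).
- exact: tN.
- by apply/negP => /(subsetP NE)/edgesP[a [b _ /setP/(_ a)]]; rewrite !inE eqxx.
move=> tvw ->; split=> //; rewrite /matching tvw andbT subUset NE andbT sub1set.
by apply/edgesP; exists v, w.
Qed.

Lemma coverU1 (e : {set G}) N : cover (e |: N) = e :|: cover N.
Proof. by rewrite /cover bigcup_setU big_set1. Qed.

Lemma matching_partner v M : matching M -> v \in cover M ->
  exists2 w, w \in nb v & forall w', ([set v; w'] \in M) = (w' == w).
Proof.
move=> /andP[ME tM] /bigcupP[e eM ve].
have [w vw eE] : exists2 w, w \in nb v & e = [set v; w].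
  have /edgesP[a [b ab eE]] := subsetP ME e eM.
  move: ve; rewrite eE !inE => /orP[]/eqP->; first by exists b.
  by exists a; rewrite 1?nb_sym // setUC.
exists w => // w'; apply/idP/eqP => [w'M | ->]; last by rewrite -eE.
have : [set v; w'] = [set v; w].
  apply/eqP; apply/negPn/negP => ne; have := trivIsetP tM _ _ w'M _ ne.
  rewrite -eE => /(_ eM) /disjointFr /(_ (set21 _ _)).
  by rewrite ve.
move/setP/(_ w); rewrite !inE eqxx orbT; case/orP => /eqP // wv.
by rewrite wv (negPf (nb_irrefl v)) in vw.
Qed.

Lemma matchingD1 v w M : matching M -> [set v; w] \in M ->
  matching (M :\ [set v; w]) /\ cover (M :\ [set v; w]) = cover M :\ v :\ w.
Proof.
move=> /andP[ME tM] eM; rewrite /matching trivIsetD // andbT coverD1 //.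
by rewrite (subset_trans (subsetDl _ _) ME) setDDl.
Qed.

Lemma big_matching_cover (K : nmodType) F v (phi : {set {set G}} -> K) : v \in F ->
  \sum_(M | matching_in F M && (v \in cover M)) phi M =
  \sum_(w in nb v :&: F) \sum_(N | matching_in (F :\ v :\ w) N) phi ([set v; w] |: N).
Proof.
move=> vF.
transitivity (\sum_(M | matching_in F M && (v \in cover M))
    \sum_(w | (w \in nb v :&: F) && ([set v; w] \in M)) phi M).
  apply: eq_bigr => M /andP[/andP[mM /subsetP cM] vM].
  have [w vw wE] := matching_partner mM vM.
  have wM : w \in cover M.
    by apply/bigcupP; exists [set v; w]; rewrite ?wE ?set22.
  rewrite (big_pred1 w) // => w' /=; rewrite wE; case: eqP => [->|_]; last by rewrite andbF.
  by rewrite inE vw cM.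
rewrite (exchange_big_dep (mem (nb v :&: F))) /=; last by move=> M w _ /andP[].
apply: eq_bigr => w /setIP[vw wF].
rewrite (reindex_onto (fun N => [set v; w] |: N) (fun M => M :\ [set v; w])) /=; last first.
  by move=> M /andP[_ /andP[_ eM]]; rewrite setD1K.
apply: eq_bigl => N; rewrite inE vw wF setU11 !andbT.
apply/andP/idP => [[/andP[/andP[mM cM] _] /eqP E] | ].
  have [mN cN] := matchingD1 mM (setU11 _ _); rewrite E in mN cN.
  by rewrite /matching_in mN cN !setSD.
rewrite !matching_inD1 => /andP[/andP[/andP[mN cN] vN] wN].
have NF : matching_in (~: [set v; w]) N.
  by rewrite /matching_in mN -setTD -setDDl !subsetD1 subsetT vN wN.
have [mM eN] := matchingU1 vw NF; split; last by rewrite setU1K.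
rewrite /matching_in mM coverU1 subUset cN subUset !sub1set vF wF /=.
by rewrite !inE eqxx.
Qed.

Lemma big_matching_exchange (K : nmodType) F S (psi : G -> {set {set G}} -> K) :
  \sum_(w in S) \sum_(N | matching_in (F :\ w) N) psi w N =
  \sum_(N | matching_in F N) \sum_(w in S :\: cover N) psi w N.
Proof.
rewrite (exchange_big_dep (matching_in F)) /=; last first.
  by move=> w N _; rewrite matching_inD1 => /andP[].
apply: eq_bigr => N NF; apply: eq_bigl => w.
by rewrite matching_inD1 NF inE andbC.
Qed.

Lemma card_cover_matching M : matching M -> #|cover M| = (2 * #|M|)%N.
Proof.
move=> /andP[/subsetP ME /eqP <-]; rewrite mulnC -sum_nat_const; apply: eq_bigr => e eM.
have /edgesP[u [v uv ->]] := ME e eM; rewrite cards2.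
by case: eqVneq uv => // ->; rewrite (negPf (nb_irrefl v)).
Qed.

Section MatchSum.
Variables (A : comNzRingType) (x : A).

Definition match_sum F := \sum_(M | matching_in F M) x ^+ #|M|.

Definition match_size_sum F := \sum_(M | matching_in F M) x ^+ #|M| *+ #|M|.

Lemma card_setU1_edge F v w N : w \in nb v -> matching_in (F :\ v :\ w) N ->
  #|[set v; w] |: N| = #|N|.+1.
Proof.
rewrite !matching_inD1 => vw /andP[/andP[/andP[mN cN] vN] wN].
have NF : matching_in (~: [set v; w]) N.
  by rewrite /matching_in mN -setTD -setDDl !subsetD1 subsetT vN wN.
by have [_ eN] := matchingU1 vw NF; rewrite cardsU1 eN.
Qed.

Lemma match_sum_rec F v : v \in F ->
  match_sum F = match_sum (F :\ v) +
    x * \sum_(w in nb v :&: F) match_sum (F :\ v :\ w).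
Proof.
move=> vF; rewrite /match_sum (bigID (fun M => v \in cover M)) /= addrC; congr (_ + _).
  by apply: eq_bigl => M; rewrite matching_inD1.
rewrite big_matching_cover // mulr_sumr; apply: eq_bigr => w /setIP[vw _].
rewrite mulr_sumr; apply: eq_bigr => N NF.
by rewrite (card_setU1_edge vw NF) exprS.
Qed.

Definition free_end u v N := nb u :\ v :\: cover N.

(* The local partition function of the edge [uv], given the matching [N] on the
   vertices other than [u] and [v]. *)
Lemma match_sumT u v : v \in nb u -> match_sum setT =
  \sum_(N | matching_in (setT :\ u :\ v) N) x ^+ #|N| * (1 + x +
    x * (#|free_end u v N| + #|free_end v u N|)%:R +
    x ^+ 2 * (\sum_(a in free_end u v N) #|free_end v u N :\ a|)%:R).
Proof.
move=> uv; set F := setT :\ u :\ v.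
have ne : v != u by apply: contraTneq uv => ->; rewrite nb_irrefl.
have exch S : \sum_(w in S) match_sum (F :\ w) =
    \sum_(N | matching_in F N) x ^+ #|N| * #|S :\: cover N|%:R.
  rewrite /match_sum (big_matching_exchange F S (fun _ N => x ^+ #|N|)).
  by apply: eq_bigr => N _; rewrite sumr_const mulr_natr.
have Eu : match_sum (setT :\ u) = match_sum F + x * \sum_(w in nb v :\ u) match_sum (F :\ w).
  rewrite (@match_sum_rec _ v) ?inE ?ne //; congr (_ + x * _).
  by apply: eq_bigl => w; rewrite !inE andbT andbC.
have Ea a : a \in nb u :\ v -> match_sum (setT :\ u :\ a) = match_sum (F :\ a) +
    x * \sum_(w in nb v :\ u :\ a) match_sum (F :\ a :\ w).
  rewrite !inE => /andP[av _]; rewrite (@match_sum_rec _ v) ?inE ?ne ?[v == a]eq_sym ?av //.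
  have -> : setT :\ u :\ a :\ v = F :\ a by rewrite /F !setDDl [[set a] :|: _]setUC.
  congr (_ + x * _); apply: eq_bigl => w; rewrite !inE andbT andbC.
  by rewrite andbA.
rewrite (@match_sum_rec _ u) ?inE // setIT (big_setD1 v) //= Eu -/F.
rewrite (eq_bigr _ Ea) big_split /= -mulr_sumr !exch.
have -> : \sum_(a in nb u :\ v) \sum_(w in nb v :\ u :\ a) match_sum (F :\ a :\ w) =
  \sum_(N | matching_in F N) x ^+ #|N| *
    (\sum_(a in free_end u v N) #|free_end v u N :\ a|)%:R.
  under eq_bigr => a _ do rewrite /match_sum
     (big_matching_exchange (F :\ a) _ (fun _ N => x ^+ #|N|)).
  rewrite big_matching_exchange; apply: eq_bigr => N _.
  rewrite natr_sum mulr_sumr; apply: eq_bigr => a _; rewrite sumr_const mulr_natr.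
  by congr (_ *+ _); apply: eq_card => w; rewrite !inE; case: (w == a); rewrite ?andbF.
rewrite /match_sum; pose e N := x ^+ #|N|.
rewrite [RHS](eq_bigr (fun N => e N + x * e N + x * (e N * #|free_end u v N|%:R) +
  x * (e N * #|free_end v u N|%:R) + x * (x * (e N *
  (\sum_(a in free_end u v N) #|free_end v u N :\ a|)%:R)))); last first.
  move=> N _; rewrite -/(e N).
  move: (\sum_(a in _) _)%N #|free_end u v N| #|free_end v u N| (e N) => s i j t.
  by rewrite natrD; ring.
rewrite !big_split /= -!mulr_sumr /e /free_end.
move: (\sum_(N | _) _) (\sum_(N | _) _ * _) (\sum_(N | _) _ * _) (\sum_(N | _) _ * _).
by move=> a b c e'; ring.
Qed.

(** Adding the edge uv to [N] produces each matching once for every vertex u that it covers, hence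
    twice per edge. *)
Lemma sum_match_sum_edges :
  \sum_u \sum_(v in nb u) \sum_(N | matching_in (setT :\ u :\ v) N) x ^+ #|N| * x =
  match_size_sum setT *+ 2.
Proof.
transitivity (\sum_u \sum_(M | matching_in setT M && (u \in cover M)) x ^+ #|M|).
  apply: eq_bigr => u _; rewrite big_matching_cover // setIT; apply: eq_bigr => v uv.
  by apply: eq_bigr => N NF; rewrite (card_setU1_edge uv NF) exprSr.
rewrite (exchange_big_dep (matching_in setT)) /=; last by move=> u M _ /andP[].
rewrite /match_size_sum -sumrMnl; apply: eq_bigr => M MT.
rewrite -mulrnA mulnC -card_cover_matching; last by case/andP: MT.
by rewrite -sumr_const; apply: eq_bigl => u; rewrite MT.
Qed.

(* Both sides are the sum over the pairs of a vertex [u] and a matching [L] avoiding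
   it of [k (d - k) y_k x ^+ #|L|], where [k] neighbours of [u] are uncovered by [L]:
   the neighbour [v] is uncovered on the left, and on the right it is matched to [w]
   by an edge of [L = vw + N]. *)
Lemma match_balance d (y : nat -> A) : regular G d ->
  \sum_u \sum_(v in nb u) \sum_(N | matching_in (setT :\ u :\ v) N)
    x ^+ #|N| * ((d - #|free_end u v N|.+1)%:R * y #|free_end u v N|.+1) =
  \sum_u \sum_(v in nb u) \sum_(N | matching_in (setT :\ u :\ v) N)
    x ^+ #|N| * (x * \sum_(w in free_end v u N)
       (#|free_end u v N :\ w|%:R * y #|free_end u v N :\ w|)).
Proof.
move=> reg; apply: eq_bigr => u _.
pose k L := #|nb u :\: cover L|.
transitivity (\sum_(L | matching_in (setT :\ u) L) x ^+ #|L| * ((k L)%:R * (d - k L)%:R * y (k L))).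
  transitivity (\sum_(v in nb u) \sum_(N | matching_in (setT :\ u :\ v) N)
     x ^+ #|N| * ((d - k N)%:R * y (k N))).
    apply: eq_bigr => v uv; apply: eq_bigr => N; rewrite !matching_inD1 => /andP[_ vN].
    have -> : k N = #|free_end u v N|.+1.
      rewrite /k (cardsD1 v) inE uv vN add1n; congr _.+1; apply: eq_card => w.
      by rewrite !inE; do !case: (_ == _); rewrite ?andbF.
    by [].
  rewrite (big_matching_exchange _ _ (fun _ N => x ^+ #|N| * ((d - k N)%:R * y (k N)))).
  apply: eq_bigr => L _; rewrite sumr_const -/(k L) -[LHS]mulr_natl.
  by move: (x ^+ _) (y _) _%:R _%:R => a b c e; ring.
transitivity (\sum_(v in nb u) \sum_(L | matching_in (setT :\ u) L && (v \in cover L))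
     x ^+ #|L| * ((k L)%:R * y (k L))).
  rewrite (exchange_big_dep (matching_in (setT :\ u))) /=; last by move=> v L _ /andP[].
  apply: eq_bigr => L LF.
  transitivity (\sum_(v in nb u :&: cover L) x ^+ #|L| * ((k L)%:R * y (k L))); last first.
    by apply: eq_bigl => v; rewrite inE LF.
  have -> : (d - k L = #|nb u :&: cover L|)%N.
    by rewrite -(reg u) -/(nb u) -(cardsID (cover L) (nb u)) addnK.
  rewrite sumr_const -[RHS]mulr_natl.
  by move: (x ^+ _) (y _) _%:R _%:R => a b c e; ring.
apply: eq_bigr => v uv; rewrite big_matching_cover; last first.
  by rewrite !inE andbT; apply: contraTneq uv => ->; rewrite nb_irrefl.
rewrite (eq_bigl (mem (nb v :\ u))) => [|w]; last by rewrite !inE andbT andbC.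
under [RHS]eq_bigr => N _ do rewrite mulrA mulr_sumr.
rewrite -big_matching_exchange.
apply: eq_bigr => w; rewrite !inE => /andP[wu vw].
apply: eq_bigr => N NF; rewrite (card_setU1_edge _ NF) ?inE // exprSr.
have -> // : k ([set v; w] |: N) = #|free_end u v N :\ w|.
rewrite /k coverU1; apply: eq_card => a; rewrite !inE !negb_or.
by do !case: (_ == _); rewrite ?andbF.
Qed.

End MatchSum.
End Matchings.

(** * Dual certificate for matchings *)

Section Dual.
Variables (R : realFieldType) (x : R) (p : nat) (A : R) (u : nat -> R).
Hypotheses (x0 : 0 < x) (A0 : 0 <= A) (u0 : u 0%N = 0).
(** Tightness of [dual_certificate] at i = j and t = 0, solved for [u]. *)
Hypothesis u_rec : forall i, (i <= p)%N ->
  (p%:R - i%:R) * u i.+1 = i.+1%:R * (A - i%:R * x * (1 - u i)).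

Let rise i := u i.+1 - u i.

(** The source term in the recurrence for [rise]: it is negative when u_i lies below s / (p + 1 +
    s), where s = i (i + 1) x. *)
Let slack i := u i * (p.+1%:R + i%:R * i.+1%:R * x) - i%:R * i.+1%:R * x.

Lemma rise_rec i : (i < p)%N ->
  (p%:R - i.+1%:R) * i.+1%:R * rise i.+1 =
    slack i.+1 + i.+1%:R * i.+2%:R * x * i%:R * rise i.
Proof.
move=> ip; have := u_rec (ltnW ip); have := u_rec ip; rewrite /rise /slack.
rewrite -[i.+2]addn2 -[i.+1]addn1 -[p.+1]addn1 !natrD.
move: (u i) (u (i + 1)) (u (i + 2)) => a b c; move: (i%:R : R) (p%:R : R) => y z.
move=> e1 e2.
have : (y + 1) * ((z - (y + 1)) * c) = (y + 1) * ((y + 2) * (A - (y + 1) * x * (1 - b))).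
  by rewrite e1.
have : (y + 2) * ((z - y) * b) = (y + 2) * ((y + 1) * (A - y * x * (1 - a))).
  by rewrite e2.
lra.
Qed.

(** The threshold s / (p + 1 + s) grows with i while [u] drops. *)
Lemma slack_step i : slack i < 0 -> u i.+1 < u i -> slack i.+1 < 0.
Proof.
rewrite /slack => si lt.
have s0 : 0 <= i%:R * i.+1%:R * x :> R by rewrite !mulr_ge0 // ltW.
have s1 : 0 < i.+1%:R * i.+2%:R * x :> R by rewrite !mulr_gt0 ?ltr0n.
have s01 : i%:R * i.+1%:R * x <= i.+1%:R * i.+2%:R * x :> R.
  by rewrite ler_pM2r // -!natrM ler_nat; lia.
have d0 : 0 < p.+1%:R :> R by rewrite ltr0n.
move: (i%:R * i.+1%:R * x) (i.+1%:R * i.+2%:R * x) (p.+1%:R : R) (u i) (u i.+1)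
  s0 s1 s01 d0 si lt => s s' d a b s0 s1 s01 d0 si ba.
have a1 : a < 1 by rewrite ltNge; apply/negP => a1; nra.
by case: (lerP b 0) => b0; nra.
Qed.

(** At a first descent the preceding rise is nonnegative, so [rise_rec] leaves only the slack to be
    negative; later descents inherit the sign by [slack_step]. There is no descent at 0, where [A0]
    applies. *)
Lemma slack_lt0 i : (i < p)%N -> rise i < 0 -> slack i < 0.
Proof.
elim: i => [|i IH] ip ri.
  have := u_rec (leq0n p); rewrite subr0 !mul0r subr0 mul1r => E.
  have : 0 <= p%:R * rise 0 by rewrite /rise u0 subr0 E.
  by rewrite leNgt pmulr_rlt0 ?ltr0n // ri.
have [ri' | ri'] := ltrP (rise i) 0.
  by apply: slack_step; [exact: IH (ltnW ip) ri' | rewrite -subr_lt0].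
have := rise_rec (ltnW ip).
have : (p%:R - i.+1%:R) * i.+1%:R * rise i.+1 < 0.
  by rewrite pmulr_rlt0 // mulr_gt0 ?ltr0n // subr_gt0 ltr_nat.
have : 0 <= i.+1%:R * i.+2%:R * x * i%:R * rise i.
  by rewrite !mulr_ge0 // ltW.
lra.
Qed.

(* Once [u] decreases it goes on decreasing, which contradicts [u_rec] at [i = p],
   where the left-hand side vanishes. *)
Lemma dual_incr i : (i < p)%N -> u i <= u i.+1.
Proof.
move=> ip; rewrite -subr_ge0 leNgt; apply/negP => ri.
have step j : (j < p)%N -> rise j < 0 ->
    (p%:R - j.+1%:R) * j.+1%:R * rise j.+1 < 0.
  move=> jp rj; rewrite rise_rec //.
  have : slack j.+1 < 0.
    by apply: slack_step; [exact: slack_lt0 | rewrite -subr_lt0].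
  have : j.+1%:R * j.+2%:R * x * j%:R * rise j <= 0.
    by rewrite mulr_ge0_le0 ?(ltW rj) // !mulr_ge0 // ltW.
  lra.
have all l : (i + l < p)%N -> rise (i + l) < 0.
  elim: l => [|l IH] lp; first by rewrite addn0.
  have lp' : (i + l < p)%N by rewrite addnS in lp; exact: ltnW.
  have := step _ lp' (IH lp'); rewrite -addnS pmulr_rlt0 //.
  by rewrite addnS mulr_gt0 ?ltr0n // subr_gt0 ltr_nat -addnS.
have lp : (i + (p.-1 - i) < p)%N by lia.
have := step _ lp (all _ lp); rewrite (_ : (i + (p.-1 - i)).+1 = p) ?subrr ?mul0r ?ltxx //.
by lia.
Qed.

Lemma dual_homo i j : (i <= j <= p)%N -> u i <= u j.
Proof.
move=> /andP[ij jp]; rewrite -(subnKC ij); have := jp; rewrite -{1}(subnKC ij).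
elim: (j - i)%N => [|l IH] lp; first by rewrite addn0.
rewrite addnS; apply: le_trans (IH _) (dual_incr _); rewrite -?addnS //.
by rewrite addnS in lp; exact: ltnW.
Qed.

(* [i], [j] and [t] are the numbers of uncovered neighbours of the two ends of an edge
   and of common ones.  There is equality when [i = j] and [t = 0], as in [K_{d,d}]. *)
Lemma dual_certificate i j t (W := fun k => x * k%:R + u k) :
    (i <= p)%N -> (j <= p)%N -> (t <= i)%N -> (t <= j)%N ->
  1 + p.+1%:R * x + A <=
    1 + x + x * (i + j)%:R + x ^+ 2 * (i%:R * j%:R - t%:R) +
    ((p%:R - i%:R) * (W i.+1 / i.+1%:R)
       - x * ((j%:R - t%:R) * W i + t%:R * W i.-1)
     + ((p%:R - j%:R) * (W j.+1 / j.+1%:R)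
       - x * ((i%:R - t%:R) * W j + t%:R * W j.-1))) / 2.
Proof.
move=> ip jp ti tj.
have E k : (k <= p)%N -> (p%:R - k%:R) * (W k.+1 / k.+1%:R) =
    (p%:R - k%:R) * x + A - k%:R * x * (1 - u k).
  move=> kp.
  have -> : W k.+1 / k.+1%:R = x + u k.+1 / k.+1%:R.
    by rewrite /W mulrDl mulfK ?pnatr_eq0.
  rewrite mulrDr [_ * (u _ / _)]mulrA u_rec //.
  by rewrite mulrAC divff ?mul1r ?addrA // pnatr_eq0.
rewrite !E //.
(* Common neighbours cost x^2 t. Since [u] is nondecreasing, W k - W k.-1 is at least x for k > 0,
   and half of the two gains at i and j repays the cost. *)
have du k : (k <= p)%N -> t%:R * (W k - W k.-1) >= t%:R * (x * (0 < k)%:R).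
  move=> kp; rewrite ler_wpM2l // /W; case: k kp => [|k] kp /=; first by lra.
  by rewrite -[k.+1]addn1 natrD addn1; have := dual_incr kp; lra.
(* For t = 0 the two sides of the certificate differ by exactly x / 2 times this product. *)
have h : 0 <= (i%:R - j%:R) * (u i - u j).
  case: (leqP i j) => [|/ltnW] ij.
    by rewrite mulr_le0 // subr_le0 ?ler_nat ?dual_homo // ij.
  by rewrite mulr_ge0 // subr_ge0 ?ler_nat ?dual_homo // ij.
have t1 k : (t <= k)%N -> t%:R * (x * (0 < k)%:R) = t%:R * x.
  by case: k => [|k]; rewrite ?mulr1 // leqn0 => /eqP->; rewrite !mul0r.
have := ler_wpM2l (ltW x0) (du i ip); have := ler_wpM2l (ltW x0) (du j jp).
have := ler_wpM2l (ltW x0) h.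
rewrite !t1 // /W -[p.+1]addn1 !natrD; lra.
Qed.

End Dual.

(** * Matching polynomial of [K_{d,d}] and solution of the dual recurrence *)

Section MatchOccupancy.
Variable R : rcfType.

Definition bip_match_poly (d : nat) : {poly R} := \poly_(k < d.+1) ('C(d, k) ^ 2 * k`!)%:R.

Lemma coef_bip_match_poly d k : (bip_match_poly d)`_k = ('C(d, k) ^ 2 * k`!)%:R.
Proof. by rewrite coef_poly; case: ltnP => // dk; rewrite bin_small. Qed.

Lemma size_bip_match_poly d : (size (bip_match_poly d) <= d.+1)%N.
Proof. exact: size_poly. Qed.

Lemma bip_match_poly_coef_rec d k :
  k.+1%:R * (bip_match_poly d)`_k.+1 =
    (d - k)%:R * ((d%:R - k%:R) * (bip_match_poly d)`_k).
Proof.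
rewrite !coef_bip_match_poly; case: (leqP k d) => kd; last first.
  by rewrite !bin_small ?mulr0 // ltnW.
rewrite -natrB // -!natrM; congr _%:R; have := mul_bin_left d k.
rewrite factS -!mulnn => e.
transitivity ((k.+1 * 'C(d, k.+1)) * (k.+1 * 'C(d, k.+1)) * k`!)%N; first by lia.
by rewrite e; lia.
Qed.

(** Deleting the ends of any of the (p + 1)^2 edges of K_{p+1,p+1} leaves K_{p,p}. *)
Lemma deriv_bip_match_poly p :
  (bip_match_poly p.+1)^`() = (p.+1 ^ 2)%:R *: bip_match_poly p.
Proof.
apply/polyP => k; rewrite coef_deriv coefZ !coef_bip_match_poly -[LHS]mulr_natr -!natrM.
congr _%:R; rewrite factS -!mulnn; have e := mul_bin_diag p.+1 k; rewrite /= in e.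
transitivity ((k.+1 * 'C(p.+1, k.+1)) * (k.+1 * 'C(p.+1, k.+1)) * k`!)%N; first by lia.
by rewrite -e; lia.
Qed.

(** Consider a left vertex of K_{p+1,p+1}. Matched to one of p + 1 partners, it leaves K_{p,p}.
    Unmatched, it leaves K_{p,p+1}, whose extra right vertex is free or joined to one of the p - k
    left vertices missed by a matching of size k. *)
Lemma bip_match_polyS p : bip_match_poly p.+1 =
  bip_match_poly p * (1 + 'X * p.+1%:R) +
  'X * (p%:R *: bip_match_poly p - theta (bip_match_poly p)).
Proof.
apply/polyP => k; rewrite mulrDr mulr1 !coefD mulrCA !coefXM -polyC_natr coefMC.
case: k => [|k] /=; first by rewrite !coef_bip_match_poly !bin0 !addr0.
rewrite coefB coef_theta coefZ !coef_bip_match_poly.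
case: (leqP k p) => kp; last by rewrite !bin_small ?mul0r ?mulr0 ?subr0 ?addr0 // ltnW.
rewrite -mulrBl -natrB // -!natrM -!natrD; congr _%:R.
rewrite factS binS -!mulnn; have := mul_bin_left p k.
move: 'C(p, k) 'C(p, k.+1) k`! => a b c e.
have [l pE] : exists l, p = (k + l)%N by exists (p - k)%N; lia.
move: e; rewrite pE addKn => e.
have e2 : (k.+1 * b * (a * c) = l * a * (a * c))%N by rewrite e.
lia.
Qed.

Section DualSequence.
Variables (x : R) (p : nat).
Hypothesis x0 : 0 < x.
Let q := bip_match_poly p.

(** This is x times the mean number of uncovered vertices on one side of K_{p,p}. *)
Definition dual_level : R := x * (p%:R * q.[x] - (theta q).[x]) / q.[x].

Lemma horner_bip_match_polyS : q.[x] != 0 ->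
  (bip_match_poly p.+1).[x] = q.[x] * (1 + p.+1%:R * x + dual_level).
Proof.
move=> qx; rewrite bip_match_polyS -/q /dual_level; move: (theta q) => r.
rewrite [RHS]mulrDr [q.[x] * (_ / _)]mulrC divfK // -polyC_natr.
by rewrite hornerD !hornerM !hornerD hornerM hornerX !hornerC hornerN hornerZ [x * p.+1%:R]mulrC.
Qed.

(** The recurrence solved forward. At index p + 1 the divisor is 0; that value only occurs
    multiplied by p - p. *)
Fixpoint dual_seq (i : nat) : R :=
  if i is j.+1 then
    j.+1%:R * (dual_level - j%:R * x * (1 - dual_seq j)) / (p%:R - j%:R)
  else 0.

Lemma bip_match_poly_gt0 : 0 < q.[x].
Proof.
have q0 k : 0 <= q`_k by rewrite coef_bip_match_poly.
apply: lt_le_trans (ler_coef_horner 0 q0 (ltW x0)).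
by rewrite coef_bip_match_poly bin0 expr0 mulr1.
Qed.

Lemma dual_level_ge0 : 0 <= dual_level.
Proof.
rewrite divr_ge0 ?(ltW bip_match_poly_gt0) // mulr_ge0 ?(ltW x0) //.
have sq := size_bip_match_poly p.
rewrite (horner_coef_wide _ sq) (horner_coef_wide _ (leq_trans (size_theta _) sq)).
rewrite mulr_sumr -sumrB sumr_ge0 // => i _.
rewrite coef_theta -mulrA -mulrBl mulr_ge0 ?mulr_ge0 ?exprn_ge0 ?(ltW x0) //.
  by rewrite subr_ge0 ler_nat -ltnS.
by rewrite coef_bip_match_poly.
Qed.

(** The extra equation is the one at i = p, where the right-hand side has to vanish. With the
    weights [a l] the recurrence telescopes, and the equation becomes the vanishing of the sum of
    a_k (A - k x), where A is [dual_level]: this says that A is x times the mean of k. *)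
Lemma dual_seq_rec i : (i <= p)%N ->
  (p%:R - i%:R) * dual_seq i.+1 = i.+1%:R * (dual_level - i%:R * x * (1 - dual_seq i)).
Proof.
rewrite leq_eqVlt => /orP[/eqP -> | ip]; last first.
  by rewrite /= mulrC divfK // subr_eq0 eqr_nat gtn_eqF.
(* The weight of the matchings of K_{p,p} that leave l vertices uncovered on each side. *)
pose a l := q`_(p - l) * x ^+ (p - l).
have aS l : (l < p)%N -> a l.+1 * x * l.+1%:R ^+ 2 = a l * (p%:R - l%:R).
  move=> lp; have := bip_match_poly_coef_rec p (p - l.+1).
  rewrite subnSK // subKn // -/q -natrB ?leq_subr // subKn // => e.
  rewrite /a -natrB ?(ltnW lp) //.
  have -> : x ^+ (p - l) = x * x ^+ (p - l.+1) by rewrite -exprS subnSK.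
  transitivity (l.+1%:R * (l.+1%:R * q`_(p - l.+1)) * x * x ^+ (p - l.+1)); first by ring.
  by rewrite -e; ring.
have tel l : (l <= p)%N -> x * l%:R * a l * dual_seq l =
    \sum_(k < l) a k * (dual_level - k%:R * x).
  elim: l => [|l IH] lp; first by rewrite big_ord0 /= mulr0.
  rewrite big_ord_recr /= -IH ?(ltnW lp) //.
  have pl : p%:R - l%:R != 0 :> R by rewrite subr_eq0 eqr_nat gtn_eqF.
  transitivity ((a l.+1 * x * l.+1%:R ^+ 2) *
     (dual_level - l%:R * x * (1 - dual_seq l)) / (p%:R - l%:R)); first by ring.
  rewrite aS // mulrAC mulfK //; ring.
have tot : \sum_(k < p.+1) a k * (dual_level - k%:R * x) = 0.
  have sq := size_bip_match_poly p.
  transitivity (dual_level * q.[x] - x * (p%:R * q.[x] - (theta q).[x])).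
    rewrite (horner_coef_wide _ sq) (horner_coef_wide _ (leq_trans (size_theta _) sq)).
    rewrite !mulr_sumr -sumrB mulr_sumr -sumrB (reindex_inj rev_ord_inj) /=.
    apply: eq_bigr => k _; rewrite /a subSS subKn -1?ltnS // coef_theta natrB -1?ltnS //.
    by ring.
  by rewrite divfK ?subrr // gt_eqF ?bip_match_poly_gt0.
move: tot; rewrite big_ord_recr /= -tel // => tot.
have ap : a p = 1 by rewrite /a subnn coef_bip_match_poly bin0 expr0 mulr1.
rewrite subrr mul0r (_ : _ - _ = 0) ?mulr0 //.
by move: tot; rewrite ap => <-; ring.
Qed.

End DualSequence.
End MatchOccupancy.

Lemma sum_card_setD1 (T : finType) (R : pzRingType) (U V : {set T}) (h : nat -> R) :
  \sum_(w in V) h #|U :\ w| =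
    (#|V|%:R - #|U :&: V|%:R) * h #|U| + #|U :&: V|%:R * h #|U|.-1.
Proof.
rewrite (big_setID U) /= addrC [V :&: U]setIC; congr (_ + _).
  rewrite (eq_bigr (fun=> h #|U|)) => [|w]; last first.
    rewrite inE => /andP[wU _]; congr (h #|pred_of_set _|); apply/setDidPl.
    by rewrite disjoint_sym disjoints1.
  rewrite sumr_const -[LHS]mulr_natl; congr (_ * _).
  by rewrite -(cardsID U V) natrD [V :&: U]setIC addrAC subrr add0r.
rewrite (eq_bigr (fun=> h #|U|.-1)) => [|w]; last first.
  by rewrite inE => /andP[wU _]; rewrite [in RHS](cardsD1 w) wU.
by rewrite sumr_const mulr_natl.
Qed.

(** * Occupancy bound for matchings *)

Section MatchBound.
Variable R : rcfType.

Definition match_poly (G : sgraph) : {poly R} := match_sum 'X [set: G].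

Lemma coef_match_poly (G : sgraph) k : (match_poly G)`_k = (num_matching G k)%:R.
Proof.
rewrite /match_poly /match_sum coef_sum /num_matching -sum1_card natr_sum.
rewrite [LHS]big_mkcond [RHS]big_mkcond /=; apply: eq_bigr => M _.
rewrite inE /matching_in subsetT andbT coefXn eq_sym.
by case: (matching M); case: eqP.
Qed.

Lemma horner_match_poly (G : sgraph) x : (match_poly G).[x] = match_sum x [set: G].
Proof. by rewrite horner_sum; apply: eq_bigr => M _; rewrite hornerXn. Qed.

Lemma horner_theta_match_poly (G : sgraph) x :
  x * (match_poly G)^`().[x] = match_size_sum x [set: G].
Proof.
rewrite /match_poly /match_sum raddf_sum horner_sum mulr_sumr; apply: eq_bigr => M _.
rewrite /= derivXn hornerMn hornerXn mulrnAr -exprS.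
by case: #|M|.
Qed.

(** Sums [dual_certificate] with weight x^|N| over ordered edges and matchings [N] avoiding both
    ends. The multiplier terms are instances of [match_balance] for the two orientations of the
    edge, so they cancel. *)
Lemma match_occupancy (G : sgraph) d x : (0 < d)%N -> regular G d -> 0 < x ->
  2 * (match_poly G)^`().[x] * (1 + d%:R * x + dual_level x d.-1) <=
    #|G|%:R * d%:R * (match_poly G).[x].
Proof.
case: d => // p _ reg x0 /=; set f' := _^`().[x]; rewrite horner_match_poly.
set A := dual_level x p; pose u := dual_seq x p.
(* The multiplier in [match_balance] is y, and k y_k = W k also at k = 0, because u 0 = 0. *)
pose W k := x * k%:R + u k; pose y k := W k / k%:R.
have Wy k : k%:R * y k = W k.
  case: k => [|k]; first by rewrite mul0r /W mulr0 add0r.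
  by rewrite mulrC divfK // pnatr_eq0.
pose B (a b : G) (N : {set {set G}}) :=
  x ^+ #|N| * ((p.+1 - #|free_end a b N|.+1)%:R * y #|free_end a b N|.+1)
  - x ^+ #|N| * (x * \sum_(w in free_end b a N)
       (#|free_end a b N :\ w|%:R * y #|free_end a b N :\ w|)).
pose T (a b : G) (N : {set {set G}}) := matching_in ([set: G] :\ a :\ b) N.
have B0 : \sum_a \sum_(b in nb a) \sum_(N | T a b N) B a b N = 0.
  under eq_bigr => a _ do (under eq_bigr => b _ do rewrite sumrB; rewrite sumrB).
  by rewrite sumrB (match_balance x y reg) subrr.
have B0' : \sum_a \sum_(b in nb a) \sum_(N | T a b N) B b a N = 0.
  rewrite -[RHS]B0 (exchange_big_dep predT) //=; apply: eq_bigr => a _.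
  apply: eq_big => [b | b _]; first by rewrite nb_sym.
  by apply: eq_bigl => N; rewrite /T !matching_inD1 -!andbA [(_ \notin _) && _]andbC.
have E1 : (\sum_a \sum_(b in nb a) \sum_(N | T a b N) x ^+ #|N|) * x = 2 * (x * f').
  rewrite horner_theta_match_poly mulr_natl -sum_match_sum_edges !mulr_suml.
  apply: eq_bigr => a _; rewrite mulr_suml; apply: eq_bigr => b _.
  by rewrite mulr_suml.
have E2 : #|G|%:R * p.+1%:R * match_sum x [set: G] =
    \sum_(a : G) \sum_(b in nb a) match_sum x [set: G].
  have cn a : #|nb a| = p.+1 := reg a.
  rewrite [RHS](eq_bigr (fun=> match_sum x [set: G] *+ p.+1)); last first.
    by move=> a _; rewrite sumr_const cn.
  by rewrite sumr_const -mulrnA -natrM mulr_natl mulnC.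
have main : (\sum_a \sum_(b in nb a) \sum_(N | T a b N) x ^+ #|N|) * (1 + p.+1%:R * x + A)
   <= #|G|%:R * p.+1%:R * match_sum x [set: G] +
    (\sum_a \sum_(b in nb a) \sum_(N | T a b N) B a b N +
     \sum_a \sum_(b in nb a) \sum_(N | T a b N) B b a N) / 2.
  rewrite E2 -big_split /= !mulr_suml -big_split /=.
  apply: ler_sum => a _; rewrite -big_split /= !mulr_suml -big_split /=.
  apply: ler_sum => b ab; rewrite (match_sumT _ ab) -big_split /= !mulr_suml -big_split /=.
  apply: ler_sum => N _.
  have ip : (#|free_end a b N| <= p)%N.
    rewrite -ltnS -(reg a) -/(nb a) (cardsD1 b (nb a)) ab ltnS.
    by rewrite subset_leq_card // subsetDl.
  have jp : (#|free_end b a N| <= p)%N.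
    rewrite -ltnS -(reg b) -/(nb b) (cardsD1 a (nb b)) nb_sym ab ltnS.
    by rewrite subset_leq_card // subsetDl.
  have := dual_certificate x0 (dual_level_ge0 p x0) (erefl : u 0%N = 0)
    (fun i => @dual_seq_rec _ x p x0 i) ip jp
    (subset_leq_card (subsetIl _ _)) (subset_leq_card (subsetIr _ _)).
  rewrite -/A => cert.
  rewrite /B !subSS !natrB // natr_sum.
  have S1 (U V : {set G}) : \sum_(w in V) (#|U :\ w|%:R * y #|U :\ w|) =
      (#|V|%:R - #|U :&: V|%:R) * W #|U| + #|U :&: V|%:R * W #|U|.-1.
    by rewrite -sum_card_setD1; apply: eq_bigr => w _; rewrite Wy.
  have S2 (U V : {set G}) : \sum_(w in U) #|V :\ w|%:R = #|U|%:R * #|V|%:R - #|U :&: V|%:R :> R.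
    rewrite (sum_card_setD1 V U (fun k => k%:R)) [V :&: U]setIC.
    case E : #|V| => [|k] /=; last by rewrite -natr1; ring.
    have : (#|U :&: V| <= #|V|)%N by rewrite subset_leq_card // subsetIr.
    by rewrite E leqn0 => /eqP ->; ring.
  rewrite !S1 S2 [free_end b a N :&: _]setIC.
  have := ler_wpM2l (exprn_ge0 #|N| (ltW x0)) cert.
  rewrite /y /W natrD -/u.
  move: #|free_end a b N| #|free_end b a N| #|_ :&: _| (x ^+ _) => i j t e.
  move: ((x * i.+1%:R + u i.+1) / _) ((x * j.+1%:R + u j.+1) / _).
  move: (x * i%:R + u i) (x * j%:R + u j) (x * i.-1%:R + u i.-1) (x * j.-1%:R + u j.-1).
  move: (i%:R : R) (j%:R : R) (t%:R : R) (p%:R : R) (p.+1%:R : R) => *.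
  lra.
move: main; rewrite B0 B0' addr0 mul0r addr0.
have -> : \sum_a \sum_(b in nb a) \sum_(N | T a b N) x ^+ #|N| = 2 * f'.
  by apply: (mulIf (lt0r_neq0 x0)); rewrite E1; ring.
by [].
Qed.

End MatchBound.

Lemma separatedS (G : sgraph) (A B C : {set G}) : A \subset B -> separated B C -> separated A C.
Proof.
move=> AB /andP[dBC /forall_inP sBC]; apply/andP; split; first exact: disjointWl dBC.
by apply/forall_inP => u uA; apply/sBC/(subsetP AB).
Qed.

Lemma joinedS (G : sgraph) (A B A' B' : {set G}) : A' \subset A -> B' \subset B ->
  joined A B -> joined A' B'.
Proof.
move=> AA BB [adjAB iA iB]; split; [|exact: independentS iA | exact: independentS iB].
by move=> u v uA vB; apply: adjAB; [exact: (subsetP AA) | exact: (subsetP BB)].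
Qed.

Section MatchExtremal.
Variables (A : comNzRingType) (x : A).

Lemma match_sum_independent (G : sgraph) (F : {set G}) : independent F -> match_sum x F = 1.
Proof.
move=> /independentP iF; rewrite /match_sum (big_pred1 set0) ?cards0 // => M /=.
apply/andP/eqP => [[/andP[/subsetP ME _] /subsetP cM] | ->]; last first.
  rewrite /matching sub0set /cover big_set0 sub0set; split=> //.
  by rewrite /trivIset /cover !big_set0 cards0.
apply/eqP; apply/set0Pn => -[e eM]; have /edgesP[u [v uv eE]] := ME e eM.
have F_e w : w \in e -> w \in F by move=> we; apply: cM; apply/bigcupP; exists e.
by have := iF v u; rewrite !F_e ?eE ?set21 ?set22 // uv => /(_ isT isT).
Qed.

(** Induction through [match_sum_rec] at a vertex of [F1]: its neighbours avoid [F2], so every term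
    keeps [F2] intact. *)
Lemma match_sumU (G : sgraph) (F1 F2 : {set G}) :
  separated F1 F2 -> match_sum x (F1 :|: F2) = match_sum x F1 * match_sum x F2.
Proof.
move: {2}#|F1| (leqnn #|F1|) => n; elim: n F1 => [|n IH] F1.
  rewrite leqn0 cards_eq0 => /eqP-> _; rewrite set0U.
  by rewrite (match_sum_independent (independent0 G)) mul1r.
have [-> _ _ | [v vF]] := set_0Vmem F1.
  by rewrite set0U (match_sum_independent (independent0 G)) mul1r.
move=> Fn sep; have /andP[dis /forall_inP nbF2] := sep.
have F1v : (#|F1 :\ v| <= n)%N by move: Fn; rewrite (cardsD1 v) vF.
have D1U w S : w \in F1 -> (S :|: F2) :\ w = S :\ w :|: F2.
  move=> wF; rewrite setDUl; congr (_ :|: _); apply/setDidPl.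
  by rewrite disjoint_sym disjoints1 (disjointFr dis wF).
rewrite (@match_sum_rec _ _ _ _ v) ?inE ?vF // (@match_sum_rec _ _ _ F1 v) //.
rewrite mulrDl D1U // IH // ?(separatedS (subsetDl _ _) sep) //; congr (_ + _).
have -> : nb v :&: (F1 :|: F2) = nb v :&: F1.
  rewrite setIUr (_ : nb v :&: F2 = set0) ?setU0 //.
  by apply/eqP; rewrite setI_eq0 nbF2.
rewrite -mulrA mulr_suml; congr (_ * _); apply: eq_bigr => w /setIP[_ wF].
rewrite D1U // IH //; first by rewrite (leq_trans _ F1v) // subset_leq_card // subsetDl.
by apply: separatedS sep; rewrite (subset_trans (subsetDl _ _)) // subsetDl.
Qed.

(** Unequal sides are needed because the recursion deletes a single vertex of the first side in one
    of its terms. *)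
Definition bip_match_sum (a b : nat) : A :=
  \sum_(k < a.+1) ('C(a, k) * 'C(b, k) * k`!)%:R * x ^+ k.

Lemma bip_match_sum_rec a b :
  bip_match_sum a.+1 b = bip_match_sum a b + x * (bip_match_sum a b.-1 *+ b).
Proof.
rewrite /bip_match_sum big_ord_recl [X in _ = X + _]big_ord_recl !bin0 -addrA; congr (_ + _).
have -> : \sum_(i < a) ('C(a, lift ord0 i) * 'C(b, lift ord0 i) *
    (lift ord0 i)`!)%:R * x ^+ lift ord0 i =
  \sum_(i < a.+1) ('C(a, i.+1) * 'C(b, i.+1) * i.+1`!)%:R * x ^+ i.+1 :> A.
  by rewrite big_ord_recr /= bin_small // mul0r addr0.
rewrite -sumrMnl mulr_sumr -big_split; apply: eq_bigr => k _ /=.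
rewrite /bump add1n -[_ *+ b]mulr_natr exprS; have e := mul_bin_diag b k.
transitivity ((('C(a, k.+1) * 'C(b, k.+1) * k.+1`!)%:R + ('C(a, k) * 'C(b.-1, k) * k`! * b)%:R)
   * (x * x ^+ k) : A); last by rewrite natrM; ring.
rewrite -natrD; congr (_%:R * _); rewrite binS factS.
transitivity ('C(a, k.+1) * 'C(b, k.+1) * (k.+1 * k`!) + 'C(a, k) * (k.+1 * 'C(b, k.+1)) * k`!)%N.
  by lia.
by rewrite -e; lia.
Qed.

Lemma match_sum_joined (G : sgraph) (F1 F2 : {set G}) : joined F1 F2 ->
  match_sum x (F1 :|: F2) = bip_match_sum #|F1| #|F2|.
Proof.
move: {2}#|F1| (erefl #|F1|) => n; elim: n F1 F2 => [|n IH] F1 F2.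
  move=> /eqP; rewrite cards_eq0 => /eqP-> [_ _ iF2]; rewrite set0U cards0.
  by rewrite match_sum_independent // /bip_match_sum big_ord1 !bin0 mul1r.
move=> F1n J; have /card_gt0P[v vF] : (0 < #|F1|)%N by rewrite F1n.
have F1v : #|F1 :\ v| = n by move: F1n; rewrite (cardsD1 v) vF => -[].
have [adjF iF1 iF2] := J.
have notF2 w : w \in F1 -> w \notin F2.
  by move=> wF; apply/negP => wF2; have := adjF w w wF wF2; rewrite (negPf (nb_irrefl w)).
have vU : v \in F1 :|: F2 by rewrite inE vF.
rewrite (match_sum_rec _ vU) F1n bip_match_sum_rec.
have E : (F1 :|: F2) :\ v = F1 :\ v :|: F2.
  by rewrite setDUl; congr (_ :|: _); apply/setDidPl; rewrite disjoint_sym disjoints1 notF2.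
have J' := joinedS (subsetDl F1 [set v]) (subxx F2) J.
rewrite E IH // F1v; congr (_ + _ * _).
have -> : nb v :&: (F1 :|: F2) = F2.
  apply/setP => w; rewrite !in_setI in_setU; apply/andP/idP => [[vw /orP[wF|//]] | wF2].
    by have /independentP/(_ w v wF vF) := iF1; rewrite vw.
  by rewrite adjF // wF2 orbT.
rewrite -sumr_const; apply: eq_bigr => w wF2.
have -> : (F1 :\ v :|: F2) :\ w = F1 :\ v :|: F2 :\ w.
  rewrite setDUl; congr (_ :|: _); apply/setDidPl; rewrite disjoint_sym disjoints1 !inE.
  by apply/negP => /andP[_ /notF2]; rewrite wF2.
by rewrite IH ?F1v //; [rewrite (cardsD1 w F2) wF2 | exact: joinedS (subsetDl _ _) J'].
Qed.

End MatchExtremal.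

Section MatchBound.
Variable R : rcfType.

Lemma match_poly_H d n : match_poly R (H d n) = bip_match_poly R d ^+ (n %/ (2 * d)).
Proof.
apply: multiplicative_copies => [| F1 F2 | i]; [|exact: match_sumU |].
  exact: match_sum_independent (independent0 _).
rewrite layer_bip (match_sum_joined _ (joined_parts _ _)) card_left_part card_right_part.
rewrite /bip_match_sum /bip_match_poly poly_def; apply: eq_bigr => k _.
by rewrite mulnn scaler_nat mulr_natl.
Qed.

Lemma match_bound (d n k : nat) (G : sgraph) :
    (0 < d)%N -> (0 < n)%N -> (2 * d %| n)%N -> #|G| = n -> regular G d ->
  (num_matching G k)%:R <= 2 * Num.sqrt (n%:R : R) * (num_matching (H d n) k)%:R.
Proof.
move=> d0 n0 dn cG reg; set m := (n %/ (2 * d))%N.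
have nE : n = (2 * d * m)%N by rewrite mulnC divnK.
have m0 : (0 < m)%N by move: n0; rewrite nE !muln_gt0 => /andP[].
have pge0 j : 0 <= (bip_match_poly R d)`_j by rewrite coef_bip_match_poly.
have psz := size_bip_match_poly R d.
have pS := bip_match_poly_coef_rec R d.
have bd : {homo (fun j => (d - j)%:R : R) : i j / (i <= j)%N >-> j <= i}.
  by move=> i j ij; rewrite ler_nat leq_sub2l.
have f0 : (match_poly R G)`_0 = 1.
  rewrite coef_match_poly (_ : num_matching G 0 = 1%N) //.
  rewrite -(cards1 (set0 : {set {set G}})).
  apply: eq_card => M; rewrite !inE cards_eq0; case: eqVneq => [->|]; rewrite ?andbF // andbT.
  by rewrite /matching sub0set /trivIset /cover !big_set0 cards0.
rewrite -!coef_match_poly match_poly_H -/m [X in Num.sqrt X%:R]nE.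
apply: coef_le_sqrt_coefX => // [j | j jd | | x x0 | x x0].
- by rewrite coef_match_poly.
- by rewrite coef_bip_match_poly ltr0n muln_gt0 expn_gt0 bin_gt0 jd fact_gt0.
- apply: (@ultra_log_concave_tp2 _ d _ (fun j => (d - j)%:R)) => // j jd.
  by rewrite coef_bip_match_poly bin_small.
- exact: ultra_log_concave_var pS bd.
apply: ler_log_deriv x0 => {x} [x x0 | x x0 | | x].
- move: x0; rewrite le_eqVlt => /predU1P[<-|]; last exact: bip_match_poly_gt0.
  by rewrite horner_coef0 coef_bip_match_poly bin0.
- case: (d) d0 => // p _; rewrite deriv_bip_match_poly hornerZ mulr_ge0 // horner_ge0 // => j.
  by rewrite coef_bip_match_poly.
- by rewrite !horner_coef0 f0 coef_bip_match_poly bin0 expr1n.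
move=> x0; have := match_occupancy d0 reg x0; rewrite cG nE.
(* With q the polynomial of K_{p,p} and A the dual level, Q' = d^2 q and Q = q (1 + d x + A), so the
   occupancy bound times q is the required comparison. *)
case: (d) d0 => // p _ /=; rewrite deriv_bip_match_poly hornerZ.
have q0 := bip_match_poly_gt0 p x0.
rewrite horner_bip_match_polyS ?gt_eqF // => /(ler_wpM2r (ltW q0)).
rewrite natrX !natrM; lra.
Qed.
End MatchBound.

Theorem theorem4 (R : rcfType) (d n : nat)
  (hd : (1 <= d)%N) (hn : (1 <= n)%N) (hdn : (2 * d %| n)%N)
  (G : sgraph) (hG : #|G| = n) (hreg : regular G d) (k : nat) :
  (num_indep G k)%:R <= 2 * Num.sqrt (n%:R : R) * (num_indep (H d n) k)%:R
  /\
  (num_matching G k)%:R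
    <= 2 * Num.sqrt (n%:R : R) * (num_matching (H d n) k)%:R.
Proof. by split; [exact: indep_bound | exact: match_bound]. Qed.
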